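(* Let $n\in\mathbb{N}^*$, $\gamma\in(0,n)$, $\beta\in[0,n/2)$ and $p_1,p_2\geq 1$. Assume that $(u_0,u_1)\in\left(L^1_{\mathrm{loc}}\cap\dot{B}_{2,\infty}^{-\beta}\right)\times\left(L^1_{\mathrm{loc}}\cap\dot{B}_{2,\infty}^{-\beta}\right)$ and that there is a constant $c>0$ such that $$u_0(x)+u_1(x)\geq c\,\langle x\rangle^{-\frac n2-\beta}\left(\log(e+|x|)\right)^{-1}\quad\text{for almost every }x\in\mathbb{R}^n,$$ where $\langle x\rangle:=(1+|x|^2)^{1/2}$. Assume in addition that $$2<p_1+p_2<1+\frac{4+2\gamma}{n+2\beta}.$$ Then the problem $$\partial_t^2u-\Delta u+\partial_tu=\mathcal{I}_\gamma\left(|u|^{p_1}\right)|u|^{p_2}\ \text{ on }(0,\infty)\times\mathbb{R}^n,\qquad u(0,\cdot)=u_0,\quad\partial_tu(0,\cdot)=u_1,$$ admits no global weak solution.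
   Context: All function spaces are on $\mathbb{R}^n$ unless indicated; $\mathbb{N}^*=\{1,2,\dots\}$. Riesz potential: for $0<\gamma<n$, $\mathcal{I}_\gamma(f)(x)=\frac{\Gamma\left(\frac{n-\gamma}{2}\right)}{2^\gamma\pi^{n/2}\Gamma\left(\frac\gamma2\right)}\int_{\mathbb{R}^n}\frac{f(y)}{|x-y|^{n-\gamma}}\,dy$. Homogeneous Besov spaces. Let $\varphi$ be a smooth radial function supported in $\{3/4\leq|\xi|\leq 8/3\}$ with $\sum_{j\in\mathbb{Z}}\varphi(2^{-j}\xi)=1$ for all $\xi\neq 0$, and let $\widehat{\dot\Delta_jf}(\xi)=\varphi(2^{-j}\xi)\widehat f(\xi)$, with $\widehat f(\xi)=\int_{\mathbb{R}^n}e^{-ix\cdot\xi}f(x)\,dx$. Let $\mathcal{S}'_h$ be the standard realization of homogeneous tempered distributions, i.e. those $f\in\mathcal{S}'(\mathbb{R}^n)$ whose low-frequency truncations $\mathcal{F}^{-1}(\theta(2^{-j}\cdot)\widehat f)$ tend to $0$ in $L^\infty$ as $j\to-\infty$ for every $\theta\in C_c^\infty(\mathbb{R}^n)$. Then $\dot{B}_{2,\infty}^{-\beta}$ is the set of $f\in\mathcal{S}'_h$ with $\|f\|_{\dot{B}_{2,\infty}^{-\beta}}:=\sup_{j\in\mathbb{Z}}2^{-j\beta}\|\dot\Delta_jf\|_{L^2}<\infty$. Weak solution. Let $p_1,p_2>0$ with $p_1+p_2>2$, $\gamma\in(0,n)$, $u_0,u_1\in L^1_{\mathrm{loc}}$,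 and put $\widetilde p:=(p_1+p_2)/2>1$. A global weak solution is a function $u\in L^{\widetilde p}_{\mathrm{loc}}([0,\infty)\times\mathbb{R}^n)$ such that $\mathcal{I}_\gamma(|u|^{p_1})|u|^{p_2}\in L^1_{\mathrm{loc}}([0,\infty)\times\mathbb{R}^n)$ and $$\int_0^\infty\int_{\mathbb{R}^n}\mathcal{I}_\gamma\left(|u|^{p_1}\right)|u|^{p_2}\phi\,dx\,dt+\int_{\mathbb{R}^n}(u_0(x)+u_1(x))\phi(0,x)\,dx-\int_{\mathbb{R}^n}u_0(x)\partial_t\phi(0,x)\,dx=\int_0^\infty\int_{\mathbb{R}^n}u\left(\partial_t^2\phi-\Delta\phi-\partial_t\phi\right)dx\,dt$$ for every $\phi\in\mathcal{C}_0^\infty([0,\infty)\times\mathbb{R}^n)$ (smooth with compact support in $[0,\infty)\times\mathbb{R}^n$, not necessarily vanishing at $t=0$). Here $\mathcal{I}_\gamma(|u|^{p_1})$ is understood as the nonnegative extended integral (possibly $+\infty$), acting in the space variable for each $t$, and on the set $\{u=0\}$ the product $\mathcal{I}_\gamma(|u|^{p_1})|u|^{p_2}$ is defined to be zero. *)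

(* Defs.v *)
From HB Require Import structures.
From mathcomp Require Import all_boot all_order all_algebra.
From mathcomp Require Import all_classical all_reals all_analysis measurable_realfun.
From mathcomp Require Import complex.

Set Implicit Arguments.
Unset Strict Implicit.
Unset Printing Implicit Defensive.
Import Order.TTheory GRing.Theory Num.Theory.
Import numFieldNormedType.Exports.
Local Open Scope classical_set_scope.
Local Open Scope ring_scope.

(** The sigma-algebra generated by the coordinates; for T = R it is the Borel
    sigma-algebra of R^n. *)

Definition measure_rV_display : measure_display -> measure_display.
Proof. exact. Qed.

Section measurable_rV.
Context {d} {T : sigmaRingType d}.
Variable n : nat.

Let coors : 'I_n -> 'rV[T]_n -> T := fun i x => x ord0 i.

Let rV_set0 : g_sigma_preimage coors set0.
Proof. exact: sigma_algebra0. Qed.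

Let rV_setC A : g_sigma_preimage coors A -> g_sigma_preimage coors (~` A).
Proof. exact: sigma_algebraC. Qed.

Let rV_bigcup (F : _^nat) : (forall i, g_sigma_preimage coors (F i)) ->
  g_sigma_preimage coors (\bigcup_i (F i)).
Proof. exact: sigma_algebra_bigcup. Qed.

HB.instance Definition _ := @isMeasurable.Build (measure_rV_display d)
  'rV[T]_n (g_sigma_preimage coors) rV_set0 rV_setC rV_bigcup.

End measurable_rV.

Section measurable_rV_theory.
Context d (T : measurableType d).

Lemma measurable_coord_rV n (i : 'I_n) :
  measurable_fun [set: 'rV[T]_n] (fun x : 'rV[T]_n => x ord0 i).
Proof.
move=> _ Y mY; rewrite setTI; apply: sub_sigma_algebra => /=.
rewrite -bigcup_seq/=; exists i => /=; first by rewrite mem_index_enum.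
by exists Y => //; rewrite setTI.
Qed.

Lemma measurable_fun_rVP d1 (T1 : measurableType d1) n (f : T1 -> 'rV[T]_n) :
  (forall i, measurable_fun [set: T1] (fun t => f t ord0 i)) ->
  measurable_fun [set: T1] f.
Proof.
move=> mf; rewrite /measurable_fun => _.
have : @measurable _ ('rV[T]_n) `<=` [set B | measurable (f @^-1` B)].
  apply: smallest_sub.
    split => /=.
    - by rewrite preimage_set0.
    - by move=> A mA; rewrite setTD preimage_setC; exact: measurableC.
    - by move=> F mF; rewrite preimage_bigcup; exact: bigcupT_measurable.
  rewrite -bigcup_seq => B [i _ [Y mY <-]] /=; rewrite setTI.
  by have := mf i measurableT _ mY; rewrite setTI.
by move=> h Y mY; rewrite setTI; exact: h.
Qed.

End measurable_rV_theory.

Section lebesgue_measure_rV.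
Context {R : realType}.
Local Notation mR := (measurableTypeR R).

Definition rV_cons n (z : mR * 'rV[R]_n) : 'rV[R]_n.+1 :=
  \row_i oapp (fun j => z.2 ord0 j) z.1 (unlift ord0 i).

Definition rV_uncons n (x : 'rV[R]_n.+1) : mR * 'rV[R]_n :=
  (x ord0 ord0, \row_j x ord0 (lift ord0 j)).

Lemma rV_consK n : cancel (@rV_cons n) (@rV_uncons n).
Proof.
move=> [a x]; rewrite /rV_uncons /rV_cons !mxE unlift_none /=; congr pair.
by apply/rowP => j; rewrite !mxE liftK.
Qed.

Lemma measurable_rV_cons n : measurable_fun setT (@rV_cons n).
Proof.
apply: measurable_fun_rVP => i; under eq_fun do rewrite mxE.
case: unliftP => [j _|_] /=; last exact: measurable_fst.
exact: (measurableT_comp (measurable_coord_rV j)).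
Qed.

Lemma measurable_rV_uncons n : measurable_fun setT (@rV_uncons n).
Proof.
apply: measurable_fun_pair; first exact: measurable_coord_rV.
apply: measurable_fun_rVP => i; under eq_fun do rewrite mxE.
exact: measurable_coord_rV.
Qed.

Section step.
Variables (n : nat) (mu : {sigma_finite_measure set 'rV[R]_n -> \bar R}).

Definition lebesgue_rV_step : set 'rV[R]_n.+1 -> \bar R :=
  pushforward (lebesgue_measure \x mu)%E (@rV_cons n).

Let step0 : lebesgue_rV_step set0 = 0%E.
Proof. by rewrite /lebesgue_rV_step /pushforward preimage_set0 measure0. Qed.

Let step_ge0 A : (0 <= lebesgue_rV_step A)%E.
Proof. exact: (measure_ge0 (lebesgue_measure \x mu)%E). Qed.

Let step_sigma_additive : semi_sigma_additive lebesgue_rV_step.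
Proof.
have mc := @measurable_rV_cons n; exact: measure_semi_sigma_additive.
Qed.

HB.instance Definition _ := isMeasure.Build _ _ _
  lebesgue_rV_step step0 step_ge0 step_sigma_additive.

Let step_sigma_finite : sigma_finite setT lebesgue_rV_step.
Proof.
have /sigma_finiteP[F [TF ndF Foo]] := sigma_finiteT (@lebesgue_measure R).
have /sigma_finiteP[G [TG ndG Goo]] := sigma_finiteT mu.
exists (fun k => @rV_uncons n @^-1` (F k `*` G k)).
  rewrite -preimage_bigcup (_ : \bigcup_k (F k `*` G k) = setT)//.
  rewrite -setXTT TF TG predeqE => -[x y]; split.
    by move=> [k _ []/= ? ?]; split; exists k.
  move=> [/= [i _ Fix] [j _ Gjy]]; exists (maxn i j) => //; split.
  - by move: x Fix; exact/subsetPset/ndF/leq_maxl.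
  - by move: y Gjy; exact/subsetPset/ndG/leq_maxr.
move=> k; have [mF Fk] := Foo k; have [mG Gk] := Goo k; split.
  rewrite -[X in measurable X]setTI; apply: measurable_rV_uncons => //.
  exact: measurableX.
rewrite /lebesgue_rV_step /pushforward -comp_preimage.
rewrite (_ : _ \o _ = id); last by rewrite funeqE => z /=; exact: rV_consK.
rewrite preimage_id product_measure1E// lte_mul_pinfty// ge0_fin_numE//.
Qed.

HB.instance Definition _ := Measure_isSigmaFinite.Build _ _ _
  lebesgue_rV_step step_sigma_finite.

End step.

Fixpoint lebesgue_rV n : {sigma_finite_measure set 'rV[R]_n -> \bar R} :=
  match n with
  | 0 => \d_(0 : 'rV[R]_0)
  | n.+1 => lebesgue_rV_step (lebesgue_rV n)
  end.

Lemma lebesgue_rV_box n (A : 'I_n -> set mR) :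
  (forall i, measurable (A i)) ->
  lebesgue_rV n [set x | forall i, A i (x ord0 i)] =
    (\prod_(i < n) lebesgue_measure (A i))%E.
Proof.
elim: n A => [|n IH] A mA.
  rewrite big_ord0 /= diracE mem_set//; by case.
have mB : measurable [set x : 'rV[R]_n | forall i, A (lift ord0 i) (x ord0 i)].
  rewrite (_ : [set x | _] = \bigcap_(i in [set: 'I_n])
      ((fun x : 'rV[R]_n => x ord0 i) @^-1` A (lift ord0 i))).
    apply: fin_bigcap_measurable => // i _; rewrite -[X in measurable X]setTI.
    by apply: measurable_coord_rV => //; exact: mA.
  by apply/seteqP; split => x /= h i; [move=> _|]; exact: h.
rewrite big_ord_recl -IH; last by move=> i; exact: mA.
rewrite [LHS]/= /lebesgue_rV_step /pushforward.
rewrite -product_measure1E//; congr (_ _).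
apply/seteqP; split => -[a x] /=.
  move=> h; split => [|i] /=.
    by have := h ord0; rewrite mxE unlift_none.
  by have := h (lift ord0 i); rewrite mxE liftK.
by move=> [h0 h] i; rewrite mxE; case: unliftP => [j ->|->]//=; exact: h.
Qed.

End lebesgue_measure_rV.

(** The library's norm on 'rV[R]_n is the sup norm; [enorm] is the Euclidean
    one. *)

Section euclidean.
Context {R : realType} {n : nat}.
Implicit Types x y : 'rV[R]_n.

Definition dotp x y : R := \sum_i x ord0 i * y ord0 i.

Definition enorm x : R := Num.sqrt (dotp x x).

Definition jbracket x : R := Num.sqrt (1 + enorm x ^+ 2).

Definition basis_vec (i : 'I_n) : 'rV[R]_n := delta_mx ord0 i.

End euclidean.

Section smooth.
Context {R : realType} {V : normedModType R}.

Definition iter_derive (f : V -> R) (vs : seq V) : V -> R :=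
  foldr (fun v g => 'D_v g) f vs.

Definition smooth (f : V -> R) :=
  forall vs x, differentiable (iter_derive f vs) x.

End smooth.

Section local_integrability.
Context {R : realType} {n : nat}.

Definition L1loc (f : 'rV[R]_n -> R) :=
  measurable_fun setT f /\
  forall K : set 'rV[R]_n, compact K ->
    (lebesgue_rV n).-integrable K (EFin \o f).

Definition halfspace : set (R * 'rV[R]_n) := [set z | 0 <= z.1].

Definition lebesgue_spacetime : set (measurableTypeR R * 'rV[R]_n) -> \bar R :=
  (lebesgue_measure \x lebesgue_rV n)%E.

HB.instance Definition _ := Measure.on lebesgue_spacetime.

(** L^1_loc([0, oo) x R^n): the compact sets may touch t = 0. *)
Definition L1loc_halfspace (f : R * 'rV[R]_n -> \bar R) :=
  measurable_fun halfspace f /\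
  forall K : set (R * 'rV[R]_n), compact K -> K `<=` halfspace ->
    lebesgue_spacetime.-integrable K f.

Definition Lploc_halfspace (p : R) (u : R * 'rV[R]_n -> R) :=
  measurable_fun halfspace u /\
  L1loc_halfspace (fun z => (`|u z| `^ p)%:E).

End local_integrability.

(** A distribution is a functional on all functions R^n -> C, of which only the
    values on Schwartz functions matter. *)

Section distributions.
Context {R : realType} {n : nat}.
Local Notation E := 'rV[R]_n.
Local Notation C := (R[i]).
Local Notation mu := (@lebesgue_rV R n).
Local Notation Re := (@complex.Re R).
Local Notation Im := (@complex.Im R).
Local Notation normc := (@Normc.normc R).

Definition csmooth (f : E -> C) := smooth (Re \o f) /\ smooth (Im \o f).

Definition cpartial (f : E -> C) (s : seq 'I_n) (x : E) : C :=
  Complex (iter_derive (Re \o f) (map basis_vec s) x)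
          (iter_derive (Im \o f) (map basis_vec s) x).

(** sup over x and over the derivatives of order at most k of
    (1 + |x|)^k |D f(x)| *)
Definition schwartz_norm (k : nat) (f : E -> C) : \bar R :=
  ereal_sup [set a | exists s x, (size s <= k)%N /\
    a = ((1 + enorm x) ^+ k * normc (cpartial f s x))%:E].

Definition schwartz (f : E -> C) :=
  csmooth f /\ forall k, (schwartz_norm k f < +oo)%E.

Definition test_function (f : E -> C) :=
  csmooth f /\ compact (closure [set x | f x != 0]).

Definition distr := (E -> C) -> C.

Implicit Types (T : distr) (f g m : E -> C).

Definition tempered T :=
  (forall (a : C) f g, schwartz f -> schwartz g ->
     T (fun x => a * f x + g x) = a * T f + T g) /\
  (exists k (M : R), forall f, schwartz f ->
     ((normc (T f))%:E <= M%:E * schwartz_norm k f)%E).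

Definition cintegral f : C :=
  Complex (\int[mu]_x Re (f x)) (\int[mu]_x Im (f x)).

Definition expi (t : R) : C := Complex (cos t) (sin t).

Definition fourier f : E -> C :=
  fun xi => cintegral (fun x => expi (- dotp x xi) * f x).

Definition inv_fourier f : E -> C := fun x =>
  ((2 * pi) ^- n)%:C%C * cintegral (fun xi => expi (dotp x xi) * f xi).

(** F^{-1}(m F(T)), where F and F^{-1} act on distributions by transposition:
    <F^{-1}(m F(T)), g> = <T, F(m F^{-1}(g))> *)
Definition fourier_mult m T : distr :=
  fun g => T (fourier (fun xi => m xi * inv_fourier g xi)).

(** [T] is the distribution given by the L^1_loc function [f]. *)
Definition regular_distr T f :=
  [/\ L1loc (Re \o f), L1loc (Im \o f) &
      forall g, test_function g -> T g = cintegral (fun x => f x * g x)].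

(** The L^p norm of [T] when it is given by a function, and +oo otherwise; all
    functions giving [T] are almost everywhere equal. *)
Definition distr_Lnorm (p : \bar R) T : \bar R :=
  ereal_inf [set Lnorm mu p (fun x => (normc (f x))%:E) |
             f in [set f | regular_distr T f]].

Definition dilate (U : Type) (j : int) (m : E -> U) : E -> U :=
  fun xi => m ((2 : R) ^ (- j) *: xi).

Definition low_freq (theta : E -> C) (j : int) T :=
  fourier_mult (dilate j theta) T.

(** The frequency scale j = - k tends to -oo. *)
Definition Sh T := tempered T /\
  forall theta, test_function theta ->
    distr_Lnorm +oo%E (low_freq theta (- k%:Z) T) @[k --> \oo] --> 0%E.

(** For [xi != 0] the family in the sum has finite support, so that the finitely supported big operator
    is the genuine sum. *)
Definition littlewood_paley (phi : E -> R) :=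
  [/\ smooth phi,
      forall xi eta, enorm xi = enorm eta -> phi xi = phi eta,
      closure [set xi | phi xi != 0] `<=`
        [set xi | 3 / 4 <= enorm xi <= 8 / 3] &
      forall xi, xi != 0 ->
        \sum_(j \in [set: int]) dilate j phi xi = 1].

Definition lp_block (phi : E -> R) (j : int) T :=
  fourier_mult (dilate j (fun xi => (phi xi)%:C%C)) T.

(** The norm of the homogeneous Besov space of regularity -beta, with
    summability indices 2 and oo *)
Definition besov_norm (phi : E -> R) (beta : R) T : \bar R :=
  ereal_sup [set ((2 `^ (- (j%:~R * beta)))%:E *
                  distr_Lnorm 2%:E (lp_block phi j T))%E | j in [set: int]].

Definition besov (phi : E -> R) (beta : R) T :=
  Sh T /\ (besov_norm phi beta T < +oo)%E.

(** The distribution [T] is determined by [u], as test functions are dense in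
    the Schwartz space. *)
Definition L1loc_besov (phi : E -> R) (beta : R) (u : E -> R) :=
  L1loc u /\
  exists T, besov phi beta T /\ regular_distr T (fun x => (u x)%:C%C).

End distributions.

Section weak_solution.
Context {R : realType} {n : nat}.
Local Notation mu := (@lebesgue_rV R n).

Definition Gamma (s : R) : R :=
  \int[lebesgue_measure]_(t in `]0, +oo[) (t `^ (s - 1) * expR (- t)).

Definition riesz_cst (gamma : R) : R :=
  Gamma ((n%:R - gamma) / 2) /
    (2 `^ gamma * pi `^ (n%:R / 2) * Gamma (gamma / 2)).

(** The density vanishes at y = x, a null set, as division by 0 gives 0. *)
Definition riesz (gamma : R) (f : 'rV[R]_n -> R) (x : 'rV[R]_n) : \bar R :=
  ((riesz_cst gamma)%:E *
   \int[mu]_y (f y / enorm (x - y) `^ (n%:R - gamma))%:E)%E.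

(** For p2 > 0 this is 0 wherever u = 0, because 0 `^ p2 = 0 and
    +oo * 0 = 0. *)
Definition nonlinearity (gamma p1 p2 : R) (u : R * 'rV[R]_n -> R)
    (z : R * 'rV[R]_n) : \bar R :=
  (riesz gamma (fun y => (`|u (z.1, y)| `^ p1)%R) z.2 * (`|u z| `^ p2)%:E)%E.

(** C_0^oo([0, oo) x R^n): smooth up to t = 0, as restrictions of smooth
    functions on R x R^n *)
Definition test_function_halfspace (phi : R * 'rV[R]_n -> R) :=
  smooth phi /\ compact (closure (halfspace `&` [set z | phi z != 0])).

Definition dt (phi : R * 'rV[R]_n -> R) : R * 'rV[R]_n -> R :=
  'D_((1, 0) : R * 'rV[R]_n) phi.

Definition dx (i : 'I_n) (phi : R * 'rV[R]_n -> R) : R * 'rV[R]_n -> R :=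
  'D_((0, basis_vec i) : R * 'rV[R]_n) phi.

Definition laplacian (phi : R * 'rV[R]_n -> R) (z : R * 'rV[R]_n) : R :=
  \sum_i dx i (dx i phi) z.

Definition weak_solution (gamma p1 p2 : R) (u0 u1 : 'rV[R]_n -> R)
    (u : R * 'rV[R]_n -> R) :=
  [/\ Lploc_halfspace ((p1 + p2) / 2) u,
      L1loc_halfspace (nonlinearity gamma p1 p2 u) &
      forall phi, test_function_halfspace phi ->
        (\int[lebesgue_spacetime]_(z in halfspace)
            (nonlinearity gamma p1 p2 u z * (phi z)%:E)
         + \int[mu]_x ((u0 x + u1 x) * phi (0%R, x))%:E
         - \int[mu]_x (u0 x * dt phi (0%R, x))%:E
         = \int[lebesgue_spacetime]_(z in halfspace)
            (u z * (dt (dt phi) z - laplacian phi z - dt phi z))%:E)%E].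

End weak_solution.

(* Main.v *)
Require Import Defs.
From HB Require Import structures.
From mathcomp Require Import all_boot all_order all_algebra.
From mathcomp Require Import all_classical all_reals all_analysis measurable_realfun.
From mathcomp Require Import ring lra.

(** Test the equation against [phi (t, x) = eta (t / r^2) * prod_i eta (x_i / r)],
    where [eta s = exp (- 1 / (1 - s^2))] on [|s| < 1]. Since [eta] is even,
    [dt phi] vanishes at [t = 0] and the [u0]-term drops out. Flatness of [eta]
    gives [|eta'|, |eta''| <= C * eta^(1/p)], where [p = (p1 + p2) / 2 > 1], so
    that the right-hand side is at most
    [C r^-2 * int int |u| phi^(1/p)]. On the support of [phi] the Riesz kernel is
    bounded below by a multiple of [r^(gamma - n)], hence by Cauchy-Schwarz the
    nonlinear term dominates [r^(gamma - n) * int_t (int_x |u|^p phi)^2]. Replacing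
    the convex functions [G^2] and [s^p] by tangent lines with slopes
    chosen so that the linear terms absorb the right-hand side, one is left with
    [int (u0 + u1) phi (0, x) dx <= C r^(n - sigma)], where
    [sigma = (2 + gamma) / (2p - 1)]. The lower bound on the data makes the left-hand
    side at least [c r^(n/2 - beta) / log r], and the subcriticality of [p1 + p2]
    says exactly that [sigma > n/2 + beta]: let [r] tend to infinity. *)

Set Implicit Arguments.
Unset Strict Implicit.
Unset Printing Implicit Defensive.
Import Order.TTheory GRing.Theory Num.Theory.
Import numFieldNormedType.Exports.
Local Open Scope classical_set_scope.
Local Open Scope ring_scope.

(** * Smooth functions built from [exp (- 1 / s)] *)

Section flat.
Context {R : realType}.
Implicit Types (P : {poly R}) (s z e theta : R).

(** The polynomial factor makes the family closed under differentiation, so that a single comparison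
    of polynomials with exponentials controls every derivative of [exp (- 1 / s)]. *)
Definition flat P s : R := if 0 < s then P.[s^-1] * expR (- s^-1) else 0.

(** Induction on the polynomial: half of the exponent bounds the lower-degree polynomial, the other
    half absorbs the extra factor through [z <= 2 / e * expR (e / 2 * z)]. *)
Lemma poly_le_expR P e : 0 < e ->
  exists2 C : R, 0 <= C & forall z, 0 <= z -> `|P.[z]| <= C * expR (e * z).
Proof.
elim/poly_ind: P e => [|P c IH] e e0.
  by exists 0 => // z z0; rewrite horner0 normr0 mul0r.
have e20 : 0 < e / 2 by rewrite divr_gt0.
have [C C0 HC] := IH _ e20.
exists (C * (2 / e) + `|c|) => [|z z0].
  by rewrite addr_ge0// mulr_ge0// divr_ge0// ltW.
rewrite hornerMXaddC mulrDl; apply: le_trans (ler_normD _ _) _; apply: lerD.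
  rewrite normrM (ger0_norm z0).
  have -> : C * (2 / e) * expR (e * z) =
      (C * expR (e / 2 * z)) * (2 / e * expR (e / 2 * z)).
    have -> : e * z = e / 2 * z + e / 2 * z by field.
    by rewrite expRD; field; rewrite gt_eqF.
  rewrite ler_pM ?HC//.
  rewrite -ler_pdivrMl ?divr_gt0// invf_div.
  by apply: le_trans (expR_ge1Dx _); rewrite lerDr.
by rewrite ler_peMr// -expR0 ler_expR mulr_ge0// ltW.
Qed.

Lemma flat1E s : 0 < s -> flat 1 s = expR (- s^-1).
Proof. by move=> s0; rewrite /flat s0 hornerE mul1r. Qed.

Lemma flat1_ge0 s : 0 <= flat 1 s.
Proof. by rewrite /flat; case: ifPn => // _; rewrite hornerE mul1r expR_ge0. Qed.

Lemma flat1_le1 s : flat 1 s <= 1.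
Proof.
rewrite /flat; case: ifPn => // s0; rewrite hornerE mul1r expR_le1.
by rewrite oppr_le0 invr_ge0 ltW.
Qed.

(** For [s > 0] and [z = s^-1], dividing by [exp (- theta z)] leaves [P(z) exp (- (1 - theta) z)],
    which is bounded because [1 - theta > 0]. *)
Lemma flat_le P theta : theta < 1 ->
  exists2 C : R, 0 <= C & forall s, `|flat P s| <= C * flat 1 s `^ theta.
Proof.
move=> t1; have e0 : 0 < 1 - theta by rewrite subr_gt0.
have [C C0 HC] := poly_le_expR P e0; exists C => // s.
have [s0|s0] := ltP 0 s; last first.
  by rewrite /flat ltNge s0 /= normr0 mulr_ge0// powR_ge0.
rewrite flat1E// -expRM /flat s0 normrM (ger0_norm (expR_ge0 _)).
rewrite -ler_pdivlMr ?expR_gt0// -mulrA -expRN -expRD.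
rewrite (_ : _ + _ = (1 - theta) * s^-1); last by ring.
by apply: HC; rewrite invr_ge0 ltW.
Qed.

(** Apply [poly_le_expR] to [P * 'X^2]. Quadratic vanishing at [0] forces a zero derivative
    there. *)
Lemma flat_le_sqr P : exists2 C : R, 0 <= C & forall s, `|flat P s| <= C * s ^+ 2.
Proof.
have [C C0 HC] := poly_le_expR (P * 'X^2) ltr01; exists C => // s.
rewrite /flat; case: ifPn => s0; last by rewrite normr0 mulr_ge0// sqr_ge0.
have := HC s^-1; rewrite invr_ge0 (ltW s0) => /(_ isT).
rewrite hornerM hornerXn mul1r normrM (ger0_norm (sqr_ge0 _)) normrM expRN.
rewrite (@ger0_norm _ (expR _)^-1) ?invr_ge0 ?expR_ge0//.
by rewrite ler_pdivrMr ?expR_gt0// exprVn ler_pdivrMr ?exprn_gt0// mulrAC.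
Qed.

(** Differentiating [P.[s^-1]] and [expR (- s^-1)] brings out [- s ^- 2] and [s ^- 2] respectively;
    this explains the factor ['X^2] and the difference of [P] and its derivative. *)
Lemma is_derive_flat P s :
  is_derive s (1 : R) (flat P) (flat ('X^2 * (P - P^`())) s).
Proof.
have [s0|s0|->] := ltgtP s 0.
- rewrite [X in is_derive _ _ _ X](_ : _ = 0); last first.
    by rewrite /flat ltNge (ltW s0).
  apply: (@near_eq_is_derive _ _ _ (cst 0)).
  by near=> x; rewrite /flat /cst ifN// -leNgt ltW//; near: x; exact: lt_nbhsl.
- have sN0 : s != 0 by rewrite gt_eqF.
  have dV : is_derive s (1 : R) (fun x : R => x^-1) (- s ^- 2).
    apply: is_derive_eq; first exact: (is_deriveV sN0).
    by rewrite /GRing.scale /= mulr1.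
  have dP : is_derive s (1 : R) (fun x => P.[x^-1]) (P^`().[s^-1] * - s ^- 2).
    exact: (@is_derive1_comp _ (horner P) (fun x : R => x^-1)).
  have dE : is_derive s (1 : R) (fun x => expR (- x^-1))
      (expR (- s^-1) * - - s ^- 2).
    exact: (@is_derive1_comp _ expR (fun x : R => - x^-1)).
  have H := is_deriveM dP dE.
  apply: is_derive_eq; first apply: (near_eq_is_derive _ H).
    by near=> x; rewrite /flat ifT//; near: x; exact: lt_nbhsr.
  rewrite /flat s0 !hornerE /GRing.scale /= exprVn.
  by field; rewrite sN0.
(* At the gluing point the absolute value of the difference quotient is squeezed between [0] and
   [C * |h|]. *)
- have [C C0 HC] := flat_le_sqr P.
  have f0 : flat P 0 = 0 by rewrite /flat ltxx.
  suff H : (h^-1 *: ((flat P \o shift 0) (h *: (1 : R)) - flat P 0)) @[h --> 0^']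
      --> (0 : R).
    apply: DeriveDef; first by apply/cvg_ex; exists 0.
    by rewrite [RHS]/flat ltxx; exact: cvg_lim H.
  apply/norm_cvg0P; apply: (@squeeze_cvgr _ _ _ _ (cst 0) (fun h => C * `|h|)).
  + near=> h; rewrite normr_ge0/= f0 subr0 addr0 /GRing.scale/= mulr1 normrM.
    have h0 : h != 0 by near: h; exact: nbhs_dnbhs_neq.
    rewrite normfV ler_pdivrMl ?normr_gt0//.
    by rewrite mulrCA -expr2 real_normK ?num_real.
  + exact: cvg_cst.
  + rewrite -[X in _ --> X](mulr0 C); apply: cvgMr.
    rewrite -[X in _ --> X](@normr0 _ R).
    by apply: cvg_norm; apply: cvg_within_filter; exact: cvg_id.
Unshelve. all: by end_near.
Qed.

Lemma continuous_flat P : continuous (flat P).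
Proof.
move=> s; apply/differentiable_continuous/derivable1_diffP.
exact: (@ex_derive _ _ _ _ _ _ _ (is_derive_flat P s)).
Qed.

End flat.

Section flat_generated.
Context {R : realType} {V : normedModType R}.

(** A class of functions that is stable under directional derivatives and
    consists of differentiable functions, hence of smooth functions. *)
Inductive flat_generated : (V -> R) -> Prop :=
| flat_generated_cst (c : R) : flat_generated (fun=> c)
| flat_generated_lin (f : V -> R) : (forall x, differentiable f x) ->
    (forall v x, 'D_v f x = f v) -> flat_generated f
| flat_generatedD f g : flat_generated f -> flat_generated g ->
    flat_generated (fun x => f x + g x)
| flat_generatedM f g : flat_generated f -> flat_generated g ->
    flat_generated (fun x => f x * g x)
| flat_generated_comp P f : flat_generated f ->
    flat_generated (fun x => flat P (f x)).

Lemma flat_generated_differentiable f x :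
  flat_generated f -> differentiable f x.
Proof.
move=> gf; elim: gf x => {f} [c|f df _|f g _ df _ dg|f g _ df _ dg|P f _ df] x.
- exact: differentiable_cst.
- exact: df.
- exact: (@differentiableD _ _ _ f g).
- exact: (@differentiableM _ _ f g).
- apply: (@differentiable_comp _ _ _ _ f (flat P)) => //.
  apply/derivable1_diffP.
  exact: (@ex_derive _ _ _ _ _ _ _ (is_derive_flat P (f x))).
Qed.

(** The chain rule does not leave the class, since the derivative of [flat P] is [flat] of another
    polynomial; hence the constructor for compositions admits every [P]. *)
Lemma flat_generated_derive f v :
  flat_generated f -> flat_generated ('D_v f).
Proof.
move=> gf; elim: gf => {f} [c|f df Df|f g gf IHf gg IHg|f g gf IHf gg IHg|P f gf IH].
- rewrite (_ : 'D_v _ = fun=> 0); first exact: flat_generated_cst.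
  by apply/funext => x; rewrite derive_cst.
- rewrite (_ : 'D_v _ = fun=> f v); first exact: flat_generated_cst.
  by apply/funext => x; exact: Df.
- rewrite (_ : 'D_v _ = fun x => 'D_v f x + 'D_v g x).
    exact: flat_generatedD.
  apply/funext => x; rewrite -deriveD//;
    exact/diff_derivable/flat_generated_differentiable.
- rewrite (_ : 'D_v _ = fun x => f x * 'D_v g x + g x * 'D_v f x).
    by apply: flat_generatedD; exact: flat_generatedM.
  apply/funext => x; rewrite (@deriveM _ _ f g)//;
    exact/diff_derivable/flat_generated_differentiable.
- rewrite (_ : 'D_v _ =
      fun x => flat ('X^2 * (P - P^`())) (f x) * 'D_v f x).
    by apply: flat_generatedM => //; exact: flat_generated_comp.
  apply/funext => x.
  have df := flat_generated_differentiable x gf.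
  have Dflat := is_derive_flat P (f x).
  have dflat : differentiable (flat P) (f x) by exact/derivable1_diffP/ex_derive.
  have dPf : differentiable (flat P \o f) x by exact: differentiable_comp.
  rewrite (_ : (fun _ => _) = flat P \o f)//.
  rewrite [LHS]deriveE// diff_comp//= -(deriveE v df) -[X in 'd (flat P) (f x) X = _]mulr1.
  rewrite [LHS]linearZ -deriveE// derive_val.
  exact: mulrC.
Qed.

Lemma flat_generated_smooth f : flat_generated f -> smooth f.
Proof.
move=> gf vs x; apply: flat_generated_differentiable.
by elim: vs => //= v vs; exact: flat_generated_derive.
Qed.

Lemma flat_generated_prod (I : Type) (r : seq I) (f : I -> V -> R) :
  (forall i, flat_generated (f i)) ->
  flat_generated (fun x => \prod_(i <- r) f i x).
Proof.
move=> gf; elim: r => [|i r IH].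
  rewrite (_ : (fun _ => _) = fun=> 1); first exact: flat_generated_cst.
  by apply/funext => x; rewrite big_nil.
rewrite (_ : (fun _ => _) = fun x => f i x * \prod_(j <- r) f j x).
  exact: flat_generatedM.
by apply/funext => x; rewrite big_cons.
Qed.

End flat_generated.

(** * The one-variable bump function and its first two derivatives *)

Section bump.
Context {R : realType}.
Implicit Types (s a theta : R).

Definition bump s : R := flat 1 (1 - s ^+ 2).

(** [flat Q1] and [flat Q2] are the first and second derivatives of [flat 1], by
    [is_derive_flat]. *)
Let Q1 : {poly R} := 'X^2 * (1 - 1^`()).
Let Q2 : {poly R} := 'X^2 * (Q1 - Q1^`()).

Definition bump' s : R := - (2 * s) * flat Q1 (1 - s ^+ 2).

Definition bump'' s : R :=
  (2 * s) ^+ 2 * flat Q2 (1 - s ^+ 2) - 2 * flat Q1 (1 - s ^+ 2).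

Let is_derive_arg s :
  is_derive s (1 : R) (fun x => 1 - x ^+ 2) (- (2 * s)).
Proof.
by apply: is_derive_eq; rewrite /GRing.scale /=; ring.
Qed.

Lemma is_derive_bump s : is_derive s (1 : R) bump (bump' s).
Proof.
have H := @is_derive1_comp _ (flat 1) (fun x => 1 - x ^+ 2) s _ _
  (is_derive_flat 1 (1 - s ^+ 2)) (is_derive_arg s).
exact: (is_derive_eq H (mulrC _ _)).
Qed.

Lemma is_derive_bump' s : is_derive s (1 : R) bump' (bump'' s).
Proof.
have H := @is_derive1_comp _ (flat Q1) (fun x => 1 - x ^+ 2) s _ _
  (is_derive_flat Q1 (1 - s ^+ 2)) (is_derive_arg s).
have L : is_derive s (1 : R) (fun x => - (2 * x)) (- 2).
  by apply: is_derive_eq; rewrite /GRing.scale/= mulr1.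
have M := is_deriveM L H.
apply: (is_derive_eq M).
by rewrite /bump'' /GRing.scale/=; ring.
Qed.

Lemma bump_ge0 s : 0 <= bump s. Proof. exact: flat1_ge0. Qed.

Lemma bump_le1 s : bump s <= 1. Proof. exact: flat1_le1. Qed.

Lemma bump_eq0 s : 1 <= `|s| -> bump s = 0.
Proof.
move=> s1; rewrite /bump /flat ltNge subr_le0 -real_normK ?num_real//.
by rewrite exprn_ege1.
Qed.

(** Here [1 - s ^+ 2] is at least [1 / 2], so the exponent is at least [- 2]. *)
Lemma bump_ge s : `|s| <= 2^-1 -> expR (- 2) <= bump s.
Proof.
move=> s1; have s2 : s ^+ 2 <= 2^-1.
  rewrite -real_normK ?num_real// (le_trans (lerXn2r 2 _ _ s1)) ?nnegrE//.
  by rewrite expr2; lra.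
rewrite /bump flat1E; last by lra.
rewrite ler_expR lerN2 -[leRHS]invrK lef_pV2 ?posrE; lra.
Qed.

Lemma bump'0 : bump' 0 = 0. Proof. by rewrite /bump' mulr0 oppr0 mul0r. Qed.

(** Where [s ^+ 2 >= 1] both derivatives vanish; elsewhere [|s| <= 1] bounds the polynomial
    prefactors and [flat_le] handles the rest. *)
Lemma bump_derive_le theta : 0 < theta < 1 ->
  exists2 C : R, 0 <= C & forall s,
    `|bump' s| <= C * bump s `^ theta /\ `|bump'' s| <= C * bump s `^ theta.
Proof.
move=> /andP[t0 t1].
have [C1 C10 H1] := flat_le Q1 t1; have [C2 C20 H2] := flat_le Q2 t1.
(* The prefactors are at most [(2 s)^2 <= 4] in front of [flat Q2] and [2] in front of [flat Q1]. *)
exists (4 * C2 + 2 * C1) => [|s]; first by rewrite addr_ge0// mulr_ge0.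
have [s1|s1] := leP 1 (s ^+ 2).
  have f0 P : flat P (1 - s ^+ 2) = 0 by rewrite /flat ltNge subr_le0 s1.
  rewrite /bump' /bump'' !f0 !mulr0 subrr normr0.
  by split; rewrite mulr_ge0 ?powR_ge0// addr_ge0// mulr_ge0.
have ns : `|s| <= 1.
  by rewrite -(@expr_le1 _ 2)// real_normK ?num_real// ltW.
have {}H1 := H1 (1 - s ^+ 2); have {}H2 := H2 (1 - s ^+ 2).
rewrite -/(bump s) in H1 H2; have p0 := powR_ge0 (bump s) theta.
split.
  rewrite /bump' normrM normrN normrM ger0_norm//.
  apply: (@le_trans _ _ (2 * (C1 * bump s `^ theta))).
    by rewrite ler_pM// ?mulr_ge0// ler_piMr.
  by rewrite mulrA ler_wpM2r// lerDr mulr_ge0.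
apply: le_trans (ler_normB _ _) _.
rewrite [leRHS]mulrDl; apply: lerD.
  rewrite normrM ger0_norm ?sqr_ge0// -mulrA; apply: ler_pM => //.
    exact: sqr_ge0.
  by rewrite exprMn; lra.
by rewrite normrM ger0_norm// -mulrA ler_wpM2l.
Qed.

Lemma measurable_bump : measurable_fun setT bump.
Proof.
apply: continuous_measurable_fun => s.
apply/differentiable_continuous/derivable1_diffP.
exact: (@ex_derive _ _ _ _ _ _ _ (is_derive_bump s)).
Qed.

Lemma measurable_bump' : measurable_fun setT bump'.
Proof.
apply: continuous_measurable_fun => s.
apply/differentiable_continuous/derivable1_diffP.
exact: (@ex_derive _ _ _ _ _ _ _ (is_derive_bump' s)).
Qed.

Lemma measurable_bump'' : measurable_fun setT bump''.
Proof.
have mf P : measurable_fun setT (fun s => flat P (1 - s ^+ 2)).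
  apply: (@measurableT_comp _ _ _ _ _ _ (flat P) _ (fun s => 1 - s ^+ 2)).
    by apply: continuous_measurable_fun; exact: continuous_flat.
  by apply: measurable_funB => //; exact: measurable_funX.
apply: measurable_funB; apply: measurable_funM => //.
by apply: measurable_funX; exact: measurable_funM.
Qed.

End bump.

(** * The cutoff in space-time *)

Section derive_along_lines.
Context {R : realType} {V : normedModType R}.
Implicit Types (f : V -> R) (g : R -> R) (x v : V).

(** The two difference quotients are the same function of [h]. This turns partial derivatives of the
    cutoff into one-variable derivatives, without differentiating products in several variables. *)
Lemma is_derive_line f g x v (a d : R) :
  (forall h, f (h *: v + x) = g (h + a)) ->
  is_derive a (1 : R) g d -> is_derive x v f d.
Proof.
move=> fg [dg <-].
have fx : f x = g a by have := fg 0; rewrite scale0r !add0r.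
have E : (fun h : R => h^-1 *: ((f \o shift x) (h *: v) - f x)) =
         (fun h : R => h^-1 *: ((g \o shift a) (h *: (1 : R)) - g a)).
  by apply/funext => h /=; rewrite fg fx /GRing.scale/= mulr1.
by apply: DeriveDef; rewrite /derivable /derive E.
Qed.

Lemma derive_line f g (a d : R) x v :
  (forall h, f (h *: v + x) = g (h + a)) ->
  is_derive a (1 : R) g d -> 'D_v f x = d.
Proof. by move=> fg /(is_derive_line fg) dg; rewrite derive_val. Qed.

Lemma derive_additive f x v :
  (forall h, f (h *: v + x) = h * f v + f x) -> 'D_v f x = f v.
Proof.
move=> fD; apply: (@derive_line _ (fun h => h * f v + f x) 0).
  by move=> h; rewrite addr0.
apply: is_derive_eq; rewrite /GRing.scale/=; ring.
Qed.

End derive_along_lines.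

Section cutoff.
Context {R : realType} {n : nat}.
Local Notation E := 'rV[R]_n.
Implicit Types (T r : R) (z : R * E) (x : E) (i : 'I_n).

Definition cutoff T r z : R := bump (z.1 / T) * \prod_i bump (z.2 ord0 i / r).

(** The part of the cutoff that is constant along [basis_vec i], so that [dx i] acts on a single
    [bump] factor. *)
Definition cutoff_tail T r i z : R :=
  bump (z.1 / T) * \prod_(j | j != i) bump (z.2 ord0 j / r).

Lemma cutoffE T r i z :
  cutoff T r z = bump (z.2 ord0 i / r) * cutoff_tail T r i z.
Proof. by rewrite /cutoff (bigD1 i)//= mulrCA. Qed.

Lemma differentiable_fst z : differentiable (fst : R * E -> R) z.
Proof.
by apply: (@linear_differentiable _ _ _ fst) => w; exact: cvg_fst.
Qed.

Lemma differentiable_snd_coord i z :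
  differentiable (fun w : R * E => w.2 ord0 i : R) z.
Proof.
apply: (@differentiable_comp _ _ _ _ (snd : R * E -> E) (fun x => x ord0 i)).
  by apply: (@linear_differentiable _ _ _ snd) => w; exact: cvg_snd.
exact: differentiable_coord.
Qed.

Lemma cutoff_smooth T r : smooth (cutoff T r).
Proof.
have gb (f : R * E -> R) c : flat_generated f ->
    flat_generated (fun z => bump (f z / c)).
  move=> gf; apply: (@flat_generated_comp _ _ 1 (fun z => 1 - (f z / c) ^+ 2)).
  rewrite (_ : (fun _ => _) = fun z => 1 + (- 1) * ((f z / c) * (f z / c))).
    apply: flat_generatedD; first exact: flat_generated_cst.
    apply: flat_generatedM; first exact: flat_generated_cst.
    by apply: flat_generatedM; apply: flat_generatedM => //;
      exact: flat_generated_cst.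
  by apply/funext => z; rewrite expr2 mulN1r.
apply: flat_generated_smooth; apply: flat_generatedM.
  apply: gb; apply: flat_generated_lin; first exact: differentiable_fst.
  by move=> v z; apply: derive_additive.
apply: flat_generated_prod => i.
apply: (gb (fun z => z.2 ord0 i)); apply: flat_generated_lin.
  exact: differentiable_snd_coord.
by move=> v z; apply: derive_additive => h; rewrite /= !mxE.
Qed.

Let is_derive_scaled (g g' : R -> R) (a b c : R) :
  (forall s, is_derive s (1 : R) g (g' s)) ->
  is_derive a (1 : R) (fun s => g (s / b) * c) (g' (a / b) / b * c).
Proof.
move=> dg.
have H := @is_derive1_comp _ g (fun s => s / b) a _ _ (dg (a / b)) _.
have L : is_derive a (1 : R) (fun s => s / b) b^-1.
  by apply: is_derive_eq; rewrite /GRing.scale/= mulr1 mulr0 ?add0r ?addr0.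
have M := is_deriveM (H _ L) (is_derive_cst c a (1 : R)).
by apply: (is_derive_eq M); rewrite /GRing.scale/=; ring.
Qed.

Lemma dt_cutoff T r : dt (cutoff T r) =
  fun z => bump' (z.1 / T) / T * \prod_i bump (z.2 ord0 i / r).
Proof.
apply/funext => z; set P := \prod_i _.
apply: (@derive_line _ _ _ (fun s => bump (s / T) * P) z.1).
  by move=> h; rewrite /cutoff /= [h%:A]mulr1 scaler0 add0r.
exact: is_derive_scaled is_derive_bump.
Qed.

Lemma dtdt_cutoff T r : dt (dt (cutoff T r)) =
  fun z => bump'' (z.1 / T) / T / T * \prod_i bump (z.2 ord0 i / r).
Proof.
apply/funext => z; rewrite dt_cutoff; set P := \prod_i _.
rewrite -mulrA.
apply: (@derive_line _ _ _ (fun s => bump' (s / T) * (T^-1 * P)) z.1).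
  by move=> h; rewrite /= [h%:A]mulr1 scaler0 add0r mulrA.
exact: is_derive_scaled is_derive_bump'.
Qed.

Lemma cutoff_tail_shift T r i h z :
  cutoff_tail T r i (h *: (0, basis_vec i) + z) = cutoff_tail T r i z.
Proof.
rewrite /cutoff_tail /= scaler0 add0r; congr (_ * _).
by apply: eq_bigr => j ji; rewrite !mxE (negbTE ji) andbF mulr0 add0r.
Qed.

Lemma dx_cutoff T r i : dx i (cutoff T r) =
  fun z => bump' (z.2 ord0 i / r) / r * cutoff_tail T r i z.
Proof.
apply/funext => z.
apply: (@derive_line _ _ _ (fun s => bump (s / r) * cutoff_tail T r i z)
  (z.2 ord0 i)).
  by move=> h; rewrite (cutoffE _ _ i) cutoff_tail_shift !mxE !eqxx mulr1.
exact: is_derive_scaled is_derive_bump.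
Qed.

Lemma dxdx_cutoff T r i : dx i (dx i (cutoff T r)) =
  fun z => bump'' (z.2 ord0 i / r) / r / r * cutoff_tail T r i z.
Proof.
apply/funext => z; rewrite dx_cutoff -mulrA.
apply: (@derive_line _ _ _
  (fun s => bump' (s / r) * (r^-1 * cutoff_tail T r i z)) (z.2 ord0 i)).
  by move=> h; rewrite cutoff_tail_shift !mxE !eqxx mulr1 -mulrA.
exact: is_derive_scaled is_derive_bump'.
Qed.

Let prod_bump01 (P : pred 'I_n) (f : 'I_n -> R) :
  0 <= \prod_(j | P j) bump (f j) <= 1.
Proof.
apply/andP; split; first by apply: prodr_ge0 => j _; exact: bump_ge0.
rewrite -[leRHS](@big1_eq _ 1 *%R _ (index_enum 'I_n) P).
by apply: ler_prod => j _; rewrite bump_ge0 bump_le1.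
Qed.

Lemma cutoff_ge0 T r z : 0 <= cutoff T r z.
Proof.
by rewrite mulr_ge0 ?bump_ge0//; case/andP: (prod_bump01 xpredT (fun i => z.2 ord0 i / r)).
Qed.

Lemma cutoff_le1 T r z : cutoff T r z <= 1.
Proof.
have /andP[? ?] := prod_bump01 xpredT (fun i => z.2 ord0 i / r).
by rewrite /cutoff -[leRHS]mulr1 ler_pM ?bump_ge0 ?bump_le1.
Qed.

Lemma cutoff_tail01 T r i z : 0 <= cutoff_tail T r i z <= 1.
Proof.
have /andP[? ?] := prod_bump01 (fun j => j != i) (fun i => z.2 ord0 i / r).
by rewrite mulr_ge0 ?bump_ge0//= /cutoff_tail -[leRHS]mulr1 ler_pM ?bump_ge0 ?bump_le1.
Qed.

(** Each of the [n.+1] factors, one in time and [n] in space, is at least [expR (- 2)] by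
    [bump_ge]. *)
Lemma cutoff_ge T r x : 0 < r -> (forall i, `|x ord0 i| <= r / 2) ->
  expR (- 2) ^+ n.+1 <= cutoff T r (0, x).
Proof.
move=> r0 xr; rewrite exprS /cutoff /= mul0r; apply: ler_pM.
- exact: expR_ge0.
- by rewrite exprn_ge0// expR_ge0.
- by apply: bump_ge; rewrite normr0 invr_ge0.
- rewrite -[X in _ ^+ X]card_ord -prodr_const; apply: ler_prod => i _.
  rewrite expR_ge0 bump_ge// normrM normfV (gtr0_norm r0).
  by rewrite ler_pdivrMr// mulrC.
Qed.

Lemma cutoff_neq0 T r z : 0 < T -> 0 < r -> cutoff T r z != 0 ->
  `|z.1| <= T /\ forall i, `|z.2 ord0 i| <= r.
Proof.
have lb (s c : R) : 0 < c -> bump (s / c) != 0 -> `|s| <= c.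
  move=> c0; apply: contraNT; rewrite -ltNge => cs; apply/eqP/bump_eq0.
  by rewrite normrM normfV (gtr0_norm c0) ler_pdivlMr// mul1r ltW.
move=> T0 r0; rewrite mulf_eq0 negb_or => /andP[/lb-/(_ T0) zT].
by rewrite prodf_seq_neq0 => /allP p; split=> // i; apply: lb => //; exact: p.
Qed.

Lemma dt_cutoff0 T r x : dt (cutoff T r) (0, x) = 0.
Proof. by rewrite dt_cutoff /= mul0r bump'0 !mul0r. Qed.

Definition damped_wave (phi : R * E -> R) z : R :=
  dt (dt phi) z - laplacian phi z - dt phi z.

(** With time scale [r ^+ 2] and space scale [r], the first time derivative and the second space
    derivatives scale like [r ^- 2], and the second time derivative like [r ^- 4], which is smaller
    since [r >= 1]. *)
Lemma damped_wave_cutoff_le theta : 0 < theta < 1 ->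
  exists2 C : R, 0 < C & forall r z, 1 <= r ->
    `|damped_wave (cutoff (r ^+ 2) r) z|
      <= C * r ^- 2 * cutoff (r ^+ 2) r z `^ theta.
Proof.
move=> /[dup] /andP[t0 t1] /bump_derive_le[C C0 HC].
(* There are two time terms and [n] space terms; [C + 1] replaces [C] to make the constant strictly
   positive. *)
exists ((n.+2)%:R * (C + 1)) => [|r z r1].
  by rewrite mulr_gt0 ?ltr0n// ltr_wpDl.
have r0 : 0 < r by exact: lt_le_trans r1.
have rN0 : r != 0 by rewrite gt_eqF.
set phi := cutoff (r ^+ 2) r.
(* Here [a] is a derivative of the factor [b], and [Q] is the product of the other factors. As [Q]
   lies in [[0, 1]], it is at most its own power of exponent [theta < 1]. *)
have key (a b Q : R) : 0 <= Q <= 1 -> 0 <= b -> `|a| <= C * b `^ theta ->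
    `|a * Q| <= (C + 1) * (b * Q) `^ theta.
  move=> /andP[Q0 Q1] b0 ab; rewrite normrM (ger0_norm Q0) powRM// mulrA.
  apply: ler_pM => //.
    by apply: le_trans ab _; rewrite ler_wpM2r ?powR_ge0// lerDl.
  have [->|QN0] := eqVneq Q 0; first exact: powR_ge0.
  rewrite -[leLHS]powRr1//; apply: ger_powR; last exact: ltW.
  by rewrite lt_neqAle eq_sym QN0 Q0.
have r2 : r ^- 2 <= 1 by rewrite invf_le1 ?exprn_gt0// exprn_ege1.
have r20 : 0 <= r ^- 2 by rewrite invr_ge0 exprn_ge0// ltW.
set B := (C + 1) * phi z `^ theta.
have B0 : 0 <= B by rewrite mulr_ge0 ?powR_ge0 ?addr_ge0.
have P01 := prod_bump01 xpredT (fun i => z.2 ord0 i / r).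
have H1 : `|dt (dt phi) z| <= r ^- 2 * B.
  rewrite /phi dtdt_cutoff.
  have -> (a t : R) : a / r ^+ 2 / r ^+ 2 * t = r ^- 2 * (r ^- 2 * (a * t)).
    by field.
  rewrite normrM (ger0_norm r20) ler_wpM2l// normrM (ger0_norm r20).
  rewrite -[leRHS]mul1r ler_pM//.
  by apply: key => //; [exact: bump_ge0|case: (HC (z.1 / r ^+ 2))].
have H2 : `|dt phi z| <= r ^- 2 * B.
  rewrite /phi dt_cutoff mulrAC mulrC.
  rewrite normrM (ger0_norm r20) ler_wpM2l//.
  by apply: key => //; [exact: bump_ge0|case: (HC (z.1 / r ^+ 2))].
have H3 : `|laplacian phi z| <= n%:R * (r ^- 2 * B).
  apply: le_trans (ler_norm_sum _ _ _) _.
  rewrite mulr_natl -[X in _ *+ X]card_ord -sumr_const; apply: ler_sum => i _.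
  rewrite dxdx_cutoff.
  have -> (a : R) (t : R) : a / r / r * t = r ^- 2 * (a * t) by field.
  rewrite normrM (ger0_norm r20) ler_wpM2l//.
  rewrite /B /phi (cutoffE _ _ i).
  apply: key; [exact: cutoff_tail01|exact: bump_ge0|].
  by case: (HC (z.2 ord0 i / r)).
apply: le_trans (ler_normB _ _) _.
apply: (@le_trans _ _ (r ^- 2 * B + n%:R * (r ^- 2 * B) + r ^- 2 * B)).
  by apply: lerD => //; apply: le_trans (ler_normB _ _) _; apply: lerD.
by rewrite -(addn2 n) natrD le_eqVlt; apply/orP; left; apply/eqP; rewrite /B; ring.
Qed.

End cutoff.

(** * Compact support and measurability of the cutoff *)

Section cutoff_support.
Context {R : realType} {n : nat}.
Local Notation E := 'rV[R]_n.
Implicit Types (T r : R) (z : R * E) (x : E) (i : 'I_n).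

Definition cube r : set E := [set x | forall i, `[- r, r]%classic (x ord0 i)].

Definition cylinder T r : set (R * E) := `[0, T]%classic `*` cube r.

Lemma compact_cube r : compact (cube r).
Proof.
apply: (@rV_compact R n (fun=> `[- r, r]%classic)) => i.
exact: segment_compact.
Qed.

Lemma compact_cylinder T r : compact (cylinder T r).
Proof. by apply: compact_setX; [exact: segment_compact|exact: compact_cube]. Qed.

Lemma cylinder_halfspace T r : cylinder T r `<=` halfspace.
Proof. by move=> z [/=]; rewrite in_itv/= => /andP[]. Qed.

Lemma cubeP r x : cube r x <-> forall i, `|x ord0 i| <= r.
Proof. by split=> h i; move: (h i); rewrite /= in_itv/= -ler_norml. Qed.

Lemma cutoff_support T r z : 0 < T -> 0 < r ->
  halfspace z -> cutoff T r z != 0 -> cylinder T r z.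
Proof.
move=> T0 r0 z0 /(cutoff_neq0 T0 r0)[zT zr]; split; last exact/cubeP.
by rewrite /= in_itv/= z0 (le_trans (ler_norm _) zT).
Qed.

Lemma test_function_cutoff T r : 0 < T -> 0 < r ->
  test_function_halfspace (@cutoff R n T r).
Proof.
move=> T0 r0; split; first exact: cutoff_smooth.
have cK : compact (cylinder T r : set (R * E)) by exact: compact_cylinder.
apply: (subclosed_compact _ cK); first exact: closed_closure.
have clK : closed (cylinder T r).
  by apply: compact_closed => //; exact: norm_hausdorff.
rewrite [X in _ `<=` X](closure_id _).1//; apply: closure_subset.
by move=> z [z0 /= fz]; exact: cutoff_support.
Qed.

Lemma measurable_cube r : measurable (cube r).
Proof.
rewrite (_ : cube r = \bigcap_(i in [set: 'I_n])
    ((fun x : E => x ord0 i) @^-1` `[- r, r]%classic)).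
  apply: fin_bigcap_measurable => // i _; rewrite -[X in measurable X]setTI.
  by apply: measurable_coord_rV => //; exact: measurable_itv.
by apply/seteqP; split => x /= h i; [move=> _|]; exact: h.
Qed.

Lemma lebesgue_cube r : 0 <= r -> lebesgue_rV n (cube r) = ((2 * r) ^+ n)%:E.
Proof.
move=> r0; rewrite /cube (@lebesgue_rV_box R n (fun=> `[- r, r]%classic)); last first.
  by move=> i; exact: measurable_itv.
rewrite (eq_bigr (fun=> (2 * r)%:E)) => [|i _].
  by rewrite prodEFin prodr_const card_ord.
rewrite lebesgue_measure_itv/= lte_fin; case: ltP => [_|].
  by rewrite -EFinB; congr _%:E; ring.
by move=> ?; congr _%:E; lra.
Qed.

Local Notation ST := (measurableTypeR R * E)%type.

Lemma measurable_cylinder T r : measurable (cylinder T r : set ST).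
Proof.
by apply: measurableX; [exact: measurable_itv|exact: measurable_cube].
Qed.

Lemma measurable_halfspace : measurable (halfspace : set ST).
Proof.
rewrite (_ : halfspace = `[0, +oo[%classic `*` setT).
  by apply: measurableX => //; exact: measurable_itv.
by apply/seteqP; split => z; rewrite /halfspace /= in_itv/= andbT => // -[].
Qed.

Let measurable_time (f : R -> R) T : measurable_fun setT f ->
  measurable_fun (setT : set ST) (fun z : ST => f (z.1 / T)).
Proof.
move=> mf; apply: (@measurableT_comp _ _ _ _ _ _ f _ (fun z : ST => z.1 / T)) => //.
by apply: measurable_funM => //; exact: measurable_fst.
Qed.

Let measurable_space (f : R -> R) r i : measurable_fun setT f ->
  measurable_fun (setT : set ST) (fun z : ST => f (z.2 ord0 i / r)).
Proof.
move=> mf.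
apply: (@measurableT_comp _ _ _ _ _ _ f _ (fun z : ST => z.2 ord0 i / r)) => //.
apply: measurable_funM => //.
exact: (measurableT_comp (measurable_coord_rV i)).
Qed.

Lemma measurable_cutoff T r : measurable_fun (setT : set ST) (cutoff T r).
Proof.
apply: measurable_funM; first exact: (@measurable_time bump T measurable_bump).
by apply: measurable_prod => i _; exact: (@measurable_space bump r i measurable_bump).
Qed.

Lemma measurable_damped_wave_cutoff T r :
  measurable_fun (setT : set ST) (damped_wave (cutoff T r)).
Proof.
rewrite /damped_wave dtdt_cutoff dt_cutoff.
have mprod (P : pred 'I_n) : measurable_fun (setT : set ST)
    (fun z => \prod_(i | P i) bump (z.2 ord0 i / r)).
  under eq_fun do rewrite -big_filter.
  by apply: measurable_prod => i _; exact: (@measurable_space bump r i measurable_bump).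
apply: measurable_funB; first apply: measurable_funB.
- apply: measurable_funM => //; apply: measurable_funM => //.
  by apply: measurable_funM => //; exact: (@measurable_time bump'' T measurable_bump'').
- rewrite /laplacian; apply: measurable_sum => i; rewrite dxdx_cutoff.
  apply: measurable_funM; last first.
    by apply: measurable_funM => //; exact: (@measurable_time bump T measurable_bump).
  apply: measurable_funM => //; apply: measurable_funM => //.
  exact: (@measurable_space bump'' r i measurable_bump'').
- apply: measurable_funM => //; apply: measurable_funM => //.
  exact: (@measurable_time bump' T measurable_bump').
Qed.

End cutoff_support.

(** * The Gamma function and the Riesz potential *)

Section gamma_function.
Context {R : realType}.
Local Notation mu := (@lebesgue_measure R).
Implicit Types s t : R.


(** Exhaust the interval by [F k], where the primitive [s^-1 * t^s] bounds the integral by [s^-1]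
    uniformly in [k], and pass to the limit by monotone convergence. *)
Lemma integral_powR_lty s : 0 < s ->
  (\int[mu]_(t in `]0%R, 1%R]) (t `^ (s - 1))%:E < +oo)%E.
Proof.
move=> s0.
(* Starting at [k.+2] keeps the left endpoint strictly below [1], as the fundamental theorem of
   calculus requires. *)
pose F (k : nat) := `[k.+2%:R^-1, 1%R]%classic : set R.
have FU : \bigcup_k F k = `]0%R, 1%R]%classic.
  apply/seteqP; split => [t [k _]|t] /=.
    rewrite /F /= !in_itv /= => /andP[kt ->]; rewrite andbT.
    by apply: lt_le_trans kt; rewrite invr_gt0 ltr0n.
  rewrite in_itv/= => /andP[t0 t1]; exists (Num.truncn t^-1) => //=.
  rewrite /F /= in_itv/= t1 andbT invf_ple ?posrE ?ltr0n//.
  apply: le_trans (ltW (truncnS_gt _)) _.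
  by rewrite ler_nat.
have mF k : measurable (F k) by exact: measurable_itv.
have bound k : (\int[mu]_(t in F k) (t `^ (s - 1))%:E <= (s^-1)%:E)%E.
  have k0 : (0 : R) < k.+2%:R^-1 by rewrite invr_gt0 ltr0n.
  have k1 : k.+2%:R^-1 < 1 :> R by rewrite invf_lt1 ?ltr1n// ltr0n.
  have cp a t : 0 < t -> {for t, continuous (fun x : R => x `^ a)}.
    move=> t0; apply/differentiable_continuous/derivable1_diffP.
    exact: (@ex_derive _ _ _ _ _ _ _ (is_derive1_powR a t0)).
  have dF t : 0 < t -> is_derive t 1 (fun x : R => s^-1 * x `^ s) (t `^ (s - 1)).
    move=> t0; have D := is_derive1_powR s t0.
    by apply: is_derive_eq; rewrite /GRing.scale/=; field; rewrite gt_eqF.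
  rewrite (@continuous_FTC2 _ _ (fun x => s^-1 * x `^ s))//.
  - rewrite powR1 mulr1 -EFinB lee_fin gerBl.
    by rewrite mulr_ge0 ?powR_ge0// invr_ge0 ltW.
  - apply: continuous_in_subspaceT => t; rewrite inE /= in_itv/= => /andP[kt _].
    by apply: cp; exact: lt_le_trans kt.
  - have cF t : 0 < t -> {for t, continuous (fun x : R => s^-1 * x `^ s)}.
      by move=> t0; apply: cvgMr; exact: cp.
    split.
    + move=> t; rewrite in_itv/= => /andP[kt _].
      exact: (@ex_derive _ _ _ _ _ _ _ (dF t (lt_trans k0 kt))).
    + by apply: cvg_at_right_filter; exact: cF.
    + by apply: cvg_at_left_filter; apply: cF.
  - move=> t; rewrite in_itv/= => /andP[kt _].
    by rewrite derive1E; have [_ ->] := dF t (lt_trans k0 kt).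
have ndF : {homo F : n m / (n <= m)%N >-> (n <= m)%O}.
  move=> n m nm; apply/subsetPset => t; rewrite /F /= !in_itv /= => /andP[nt ->].
  rewrite andbT (le_trans _ nt)// lef_pV2 ?posrE ?ltr0n// ler_nat.
  by rewrite !ltnS.
have mf k : measurable_fun (F k) (fun t => (t `^ (s - 1))%:E).
  apply/measurable_EFinP; apply: measurable_funTS; exact: measurable_powR.
have f0 (i : nat) t : F i t -> (0 <= (t `^ (s - 1))%:E)%E.
  by rewrite lee_fin powR_ge0.
have cv : ((\int[mu]_(t in F i) (t `^ (s - 1))%:E)%E @[i --> \oo] -->
    (\int[mu]_(t in \bigcup_i F i) (t `^ (s - 1))%:E)%E).
  exact: ge0_nondecreasing_set_cvg_integral.
rewrite FU in cv; rewrite -(cvg_lim _ cv)//.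
apply: (@le_lt_trans _ _ (s^-1)%:E); last exact: ltry.
by apply: lime_le; [apply/cvg_ex; eexists; exact: cv|near=> k; exact: bound].
Unshelve. all: by end_near.
Qed.

(** For [t >= 1] the real power is dominated by an integer one, which costs half of the exponential
    decay. *)
Lemma powR_expR_le s : exists2 C, 0 <= C &
  forall t, 1 <= t -> t `^ s * expR (- t) <= C * expR (- (2^-1 * t)).
Proof.
have h0 : (0 : R) < 2^-1 by rewrite invr_gt0.
have [C C0 HC] := poly_le_expR ('X ^+ (Num.truncn s).+1) h0; exists C => // t t1.
have t0 : 0 <= t by exact: le_trans t1.
apply: (@le_trans _ _ ((C * expR (2^-1 * t)) * expR (- t))).
  rewrite ler_wpM2r ?expR_ge0//; apply: le_trans (HC _ t0).
  rewrite hornerXn ger0_norm ?exprn_ge0// -powR_mulrn//.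
  by apply: ler_powR => //; exact: ltW (truncnS_gt _).
rewrite -mulrA -expRD le_eqVlt; apply/orP; left; apply/eqP.
by congr (_ * expR _); field.
Qed.

(** [Gamma] is the real part [fine] of an extended integral and would be [0] if that integral were
    infinite. Positivity therefore needs both a lower bound and finiteness. *)
Lemma Gamma_gt0 s : 0 < s -> 0 < Gamma s.
Proof.
move=> s0; rewrite /Gamma /Rintegral; pose f t : R := t `^ (s - 1) * expR (- t).
rewrite -[X in fine X]/(\int[mu]_(t in `]0%R, +oo[) (f t)%:E)%E.
have f0 t : 0 <= f t by rewrite /f mulr_ge0 ?powR_ge0 ?expR_ge0.
have mf : measurable_fun setT f.
  apply: measurable_funM; first exact: measurable_powR.
  apply: (@measurableT_comp _ _ _ _ _ _ expR _ (fun t : R => - t)).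
    exact: measurable_expR.
  exact: oppr_measurable.
have mEf D : measurable_fun D (EFin \o f).
  by apply: measurable_funTS; exact/measurable_EFinP.
apply: fine_gt0; apply/andP; split.
  (* On [[1, 2]] one has [t^(s - 1) >= t^-1 >= 1 / 2] and [expR (- t) >= expR (- 2)]. *)
  apply: (@lt_le_trans _ _ (\int[mu]_(t in `[1%R, 2%R]) (2^-1 * expR (- 2))%:E)%E).
    rewrite integral_cst//= lebesgue_measure_itv/= lte_fin ltr1n -EFinD -EFinM lte_fin.
    by rewrite mulr_gt0 ?mulr_gt0 ?expR_gt0//; lra.
  apply: (@le_trans _ _ (\int[mu]_(t in `[1%R, 2%R]) (f t)%:E)%E); last first.
    apply: ge0_subset_integral => //; [exact: mEf|by move=> t _; rewrite lee_fin|].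
    by apply: subset_itv; rewrite bnd_simp.
  apply: ge0_le_integral => //.
  - exact: mEf.
  - move=> t /=; rewrite in_itv/= lee_fin => /andP[t1 t2].
    apply: ler_pM; rewrite ?expR_ge0 ?ler_expR ?lerN2//.
    apply: (@le_trans _ _ (t `^ (- 1))).
      rewrite powR_inv1; last by rewrite (le_trans _ t1).
      by rewrite lef_pV2 ?posrE// (lt_le_trans _ t1).
    by apply: ler_powR => //; rewrite lerDr ltW.
have -> : `]0%R, +oo[%classic = `]0%R, 1%R] `|` `]1%R, +oo[ :> set R.
  by rewrite -itv_bndbnd_setU// bnd_simp.
rewrite ge0_integral_setU//=; last 3 first.
- exact: mEf.
- by move=> t _; rewrite lee_fin.
- apply/disj_setPS => t /= [].
  by rewrite !in_itv/= => /andP[_ t1]; rewrite andbT ltNge t1.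
apply: lte_add_pinfty.
  apply: le_lt_trans (integral_powR_lty s0); apply: ge0_le_integral => //.
  - by move=> t _; rewrite lee_fin.
  - exact: mEf.
  - by apply/measurable_EFinP; apply: measurable_funTS; exact: measurable_powR.
  - move=> t /=; rewrite in_itv/= lee_fin => /andP[t0 _].
    by rewrite /f ler_piMr ?powR_ge0// expR_le1 oppr_le0 ltW.
(* The tail is compared with the exponential density of rate [1 / 2], whose integral is [1]; the
   factor [2] cancels the rate in front of that density. *)
have [C C0 HC] := powR_expR_le (s - 1).
have mpdf : measurable_fun setT (fun t => (C * 2 * exponential_pdf 2^-1 t)%:E).
  apply/measurable_EFinP; apply: measurable_funM => //.
  exact: measurable_exponential_pdf.
have pdf0 t : 0 <= exponential_pdf (2^-1 : R) t by exact: exponential_pdf_ge0.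
apply: (@le_lt_trans _ _ (\int[mu]_t (C * 2 * exponential_pdf 2^-1 t)%:E)%E).
  apply: (@le_trans _ _
    (\int[mu]_(t in `]1%R, +oo[) (C * 2 * exponential_pdf 2^-1 t)%:E)%E).
    apply: ge0_le_integral => //.
    - by move=> t _; rewrite lee_fin.
    - exact: mEf.
    - exact: measurable_funTS.
    - move=> t /=; rewrite in_itv/= andbT lee_fin => t1.
      apply: le_trans (HC _ (ltW t1)) _.
      rewrite exponential_pdfE ?(le_trans _ (ltW t1))// mulNr.
      by rewrite -mulrA [2 * _]mulrA divff// mul1r.
  apply: ge0_subset_integral => // t _; rewrite lee_fin.
  by rewrite !mulr_ge0.
under eq_integral do rewrite EFinM.
rewrite ge0_integralZl_EFin//.
- by rewrite integral_exponential_pdf ?invr_gt0// mule1 ltry.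
- by move=> t _; rewrite lee_fin.
- by apply/measurable_EFinP; exact: measurable_exponential_pdf.
- by rewrite mulr_ge0.
Qed.

Lemma riesz_cst_gt0 (n : nat) (gamma : R) : 0 < gamma < n%:R ->
  0 < @riesz_cst R n gamma.
Proof.
move=> /andP[g0 gn]; rewrite /riesz_cst divr_gt0 ?mulr_gt0 ?powR_gt0 ?pi_gt0//.
- by rewrite Gamma_gt0// divr_gt0// subr_gt0.
- by rewrite Gamma_gt0// divr_gt0.
Qed.

End gamma_function.

Section cauchy_schwarz.
Context {d} {T : measurableType d} {R : realType}.
Variable mu : {measure set T -> \bar R}.
Implicit Types (f g : T -> R) (m : R).

(** Cauchy-Schwarz, with the square of [\int f g] replaced by its tangent line
    at [m]; in this form no finiteness is needed. *)
Lemma cauchy_schwarz_tangent f g m :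
  measurable_fun setT f -> measurable_fun setT g ->
  (forall x, 0 <= f x) -> (forall x, 0 <= g x) -> 0 <= m ->
  ((2 * m)%:E * \int[mu]_x (f x * g x)%:E
     <= (\int[mu]_x (f x ^+ 2)%:E) * (\int[mu]_x (g x ^+ 2)%:E) + (m ^+ 2)%:E)%E.
Proof.
move=> mf mg f0 g0 m0.
have h2 : (0 : R) < 2 by [].
have hh : (2^-1 + 2^-1 = 1 :> R) by field.
have := hoelder mu mf mg h2 h2 hh.
rewrite Lnorm1 unlock /=.
have sqE (k : T -> R) : (forall x, 0 <= k x) ->
    (\int[mu]_x (`|(k x)%:E| `^ 2) = \int[mu]_x (k x ^+ 2)%:E)%E.
  move=> k0; apply: eq_integral => x _.
  by rewrite gee0_abs ?lee_fin// poweR_EFin powR_mulrn.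
have -> : (\int[mu]_x `|(EFin \o (f \* g)%R) x| = \int[mu]_x (f x * g x)%:E)%E.
  by apply: eq_integral => x _; rewrite gee0_abs// lee_fin mulr_ge0.
rewrite !sqE//; set A := (\int[mu]_x (f x ^+ 2)%:E)%E.
set B := (\int[mu]_x (g x ^+ 2)%:E)%E.
have A0 : (0 <= A)%E by apply: integral_ge0 => x _; rewrite lee_fin sqr_ge0.
have B0 : (0 <= B)%E by apply: integral_ge0 => x _; rewrite lee_fin sqr_ge0.
rewrite -poweRM//; have := mule_ge0 A0 B0.
(* An infinite product makes the bound trivial. For a finite product [s], expand the square of
   [sqrt s - m], which is nonnegative. *)
case: (A * B)%E => [s|_ _|//]; last by rewrite addye// leey.
rewrite lee_fin => s0; rewrite poweR_EFin => Gs.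
apply: le_trans (lee_wpmul2l _ Gs) _; first by rewrite lee_fin mulr_ge0.
rewrite -EFinM lee_fin; have := sqr_ge0 (s `^ 2^-1 - m).
have : (s `^ 2^-1) ^+ 2 = s.
  by rewrite -powR_mulrn ?powR_ge0// -powRrM mulVf// powRr1.
by rewrite sqrrB; lra.
Qed.

End cauchy_schwarz.

(** * Null points and a lower bound for the Riesz potential on a cube *)

Section slice.
Context {R : realType} {n : nat}.
Local Notation E := 'rV[R]_n.
Local Notation mu := (@lebesgue_rV R n).
Hypothesis n0 : (0 < n)%N.
Implicit Types (x y : E) (r gamma : R) (v w : E -> R).

(** One factor of the box is null as soon as [n > 0]; in dimension [0] the point has mass [1]. *)
Lemma lebesgue_rV_point x : mu [set x] = 0%E.
Proof.
rewrite (_ : [set x] = [set y : E | forall i, [set x ord0 i] (y ord0 i)]).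
  rewrite (@lebesgue_rV_box R n (fun i => [set x ord0 i])); last first.
    by move=> i; exact: measurable_set1.
  rewrite (bigD1 (Ordinal n0))//= lebesgue_measure_set1 mul0e//.
apply/seteqP; split => y /=; first by move->.
by move=> xy; apply/rowP => i; exact: xy.
Qed.

Lemma ae_neq_point x : {ae mu, forall y, y <> x}.
Proof.
exists [set x]; split; last by move=> y /= /contrapT.
- rewrite (_ : [set x] = \bigcap_(i in [set: 'I_n])
    ((fun y : E => y ord0 i) @^-1` [set x ord0 i])).
    apply: fin_bigcap_measurable => // i _; rewrite -[X in measurable X]setTI.
    by apply: measurable_coord_rV => //; exact: measurable_set1.
  apply/seteqP; split => y /=; first by move->.
  by move=> xy; apply/rowP => i; exact: xy.
- exact: lebesgue_rV_point.
Qed.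

Lemma enorm_le (M : R) x : 0 <= M -> (forall i, `|x ord0 i| <= M) ->
  enorm x <= n%:R * M.
Proof.
move=> M0 xM; have nM0 : 0 <= n%:R * M by rewrite mulr_ge0.
rewrite /enorm -[leRHS](ger0_norm nM0) -sqrtr_sqr; apply: ler_wsqrtr.
apply: (@le_trans _ _ (n%:R * M ^+ 2)).
  rewrite mulr_natl -[X in _ *+ X]card_ord -sumr_const; apply: ler_sum => i _.
  by rewrite -expr2 -real_normK ?num_real// lerXn2r// nnegrE.
rewrite exprMn ler_wpM2r ?sqr_ge0// expr2 ler_peMl// ler1n//.
Qed.

Lemma enorm_gt0 x : x != 0 -> 0 < enorm x.
Proof.
move=> xN0; rewrite sqrtr_gt0 lt_neqAle sumr_ge0 ?andbT => [|i _]; last first.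
  by rewrite -expr2 sqr_ge0.
apply: contra xN0 => /eqP/esym/eqP; rewrite psumr_eq0 => [/allP h|i _]; last first.
  by rewrite -expr2 sqr_ge0.
apply/eqP/rowP => i; rewrite mxE; apply/eqP.
by have := h i (mem_index_enum _); rewrite mulf_eq0 orbb.
Qed.

Lemma measurable_enormB x : measurable_fun setT (fun y => enorm (x - y)).
Proof.
rewrite /enorm.
apply: (@measurableT_comp _ _ _ _ _ _ (@Num.sqrt R) _ (fun y => dotp (x - y) (x - y))).
  by apply: continuous_measurable_fun; exact: sqrt_continuous.
apply: measurable_sum => i; under eq_fun do rewrite !mxE.
have mB : measurable_fun setT (fun y : E => x ord0 i - y ord0 i).
  by apply: measurable_funB => //; exact: measurable_coord_rV.
exact: measurable_funM.
Qed.

(** Points of the cube are at Euclidean distance at most [2 n r], and the kernel decreases with the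
    distance because [gamma < n]; the integral outside the cube is discarded. *)
Lemma riesz_ge gamma r v x : 0 < gamma < n%:R -> 0 < r -> cube r x ->
  measurable_fun setT v -> (forall y, 0 <= v y) ->
  ((@riesz_cst R n gamma * (2 * n%:R * r) `^ (gamma - n%:R))%:E
     * \int[mu]_(y in cube r) (v y)%:E <= riesz gamma v x)%E.
Proof.
move=> /[dup] hg /andP[g0 gn] r0 xQ mv v0; rewrite /riesz EFinM -muleA.
have a0 : 0 < n%:R - gamma by rewrite subr_gt0.
apply: lee_wpmul2l; first by rewrite lee_fin ltW// riesz_cst_gt0.
have mf : measurable_fun setT
    (fun y => (v y / enorm (x - y) `^ (n%:R - gamma))%:E).
  apply/measurable_EFinP; apply: measurable_funM => //.
  under eq_fun do rewrite -powRN.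
  apply: (@measurableT_comp _ _ _ _ _ _ (fun s : R => s `^ - (n%:R - gamma)) _
    (fun y => enorm (x - y))); first exact: measurable_powR.
  exact: measurable_enormB.
have f0 y : (0 <= (v y / enorm (x - y) `^ (n%:R - gamma))%:E)%E.
  by rewrite lee_fin divr_ge0// powR_ge0.
have mQ := @measurable_cube R n r.
apply: (@le_trans _ _ (\int[mu]_(y in cube r)
    (v y / enorm (x - y) `^ (n%:R - gamma))%:E)%E); last first.
  by apply: ge0_subset_integral.
rewrite -ge0_integralZl_EFin//; last 3 first.
- by move=> y _; rewrite lee_fin.
- by apply: measurable_funTS; exact/measurable_EFinP.
- exact: powR_ge0.
(* At [y = x] the quotient is [0] because division by [0] gives [0], so the
   comparison only holds off the null set [[set x]]. *)
apply: ae_ge0_le_integral => //.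
- by move=> y _; rewrite -EFinM lee_fin mulr_ge0 ?powR_ge0.
- by apply: measurable_funTS; apply: emeasurable_funM => //; exact/measurable_EFinP.
- exact: measurable_funTS.
apply: filterS (ae_neq_point x) => y yx yQ.
rewrite -EFinM lee_fin mulrC ler_wpM2l// -opprB powRN lef_pV2 ?posrE ?powR_gt0//.
- apply: ge0_ler_powR; rewrite ?nnegrE ?sqrtr_ge0 ?mulr_ge0 ?(ltW a0) ?(ltW r0)//.
  have -> : 2 * n%:R * r = n%:R * (2 * r) by ring.
  apply: enorm_le => [|i]; first by rewrite mulr_ge0// ltW.
  rewrite !mxE; apply: le_trans (ler_normB _ _) _.
  by move/cubeP : xQ => /(_ i); move/cubeP : yQ => /(_ i); lra.
- by rewrite !mulr_gt0// ltr0n.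
- by rewrite enorm_gt0// subr_eq0 eq_sym; exact/eqP.
Qed.

End slice.

(** * The nonlinear term against the cutoff *)

(** The graph of the convex function [s^p] lies above its tangent at [h]. This is Young's inequality
    for [s] and [h^(p - 1)] with the conjugate exponents [p] and [p / (p - 1)]. *)
Lemma young_tangent {R : realType} (p s h : R) : 1 < p -> 0 <= s -> 0 <= h ->
  p * h `^ (p - 1) * s <= s `^ p + (p - 1) * h `^ p.
Proof.
move=> p1 s0 h0.
have p0 : 0 < p by exact: lt_trans p1.
have pB0 : 0 < p - 1 by rewrite subr_gt0.
have q0 : 0 < p / (p - 1) by exact: divr_gt0.
have pq : p^-1 + (p / (p - 1))^-1 = 1 by field; rewrite ?gt_eqF.
have := conjugate_powR s0 (powR_ge0 h (p - 1)) p0 q0 pq.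
rewrite -powRrM mulrCA divff ?gt_eqF// mulr1 -(ler_pM2l p0) => /le_trans.
rewrite mulrAC -mulrA; apply; rewrite le_eqVlt; apply/orP; left; apply/eqP.
by field; rewrite ?gt_eqF.
Qed.

Section slice_estimate.
Context {R : realType} {n : nat}.
Local Notation E := 'rV[R]_n.
Local Notation mu := (@lebesgue_rV R n).
Hypothesis n0 : (0 < n)%N.
Variables (gamma p1 p2 r h : R) (v w : E -> R).
Hypotheses (hgamma : 0 < gamma < n%:R) (r0 : 0 < r) (h0 : 0 <= h).
Hypotheses (p10 : 0 < p1) (p20 : 0 < p2) (hp : 1 < (p1 + p2) / 2).
Hypotheses (mv : measurable_fun setT v) (mw : measurable_fun setT w).
Hypotheses (v0 : forall x, 0 <= v x) (w01 : forall x, 0 <= w x <= 1).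
Hypothesis wQ : forall x, w x != 0 -> cube r x.

Let p := (p1 + p2) / 2.
(** [k] is the kernel bound of [riesz_ge]. [m], which is [h^p] times the volume of the cube, is the
    point at which the square of [G] is linearised. *)
Let k := @riesz_cst R n gamma * (2 * n%:R * r) `^ (gamma - n%:R).
Let m := h `^ p * (2 * r) ^+ n.
Let X x : \bar R := (riesz gamma (fun y => (v y `^ p1)%R) x * (v x `^ p2)%:E * (w x)%:E)%E.

Let mpow (f : E -> R) a : measurable_fun setT f ->
  measurable_fun setT (fun x => f x `^ a).
Proof.
by move=> mf; apply: (@measurableT_comp _ _ _ _ _ _ (fun s : R => s `^ a) _ f).
Qed.

Let w0 x : 0 <= w x. Proof. by case/andP: (w01 x). Qed.

Let G := (\int[mu]_x (v x `^ p * w x)%:E)%E.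

Let mvw a : measurable_fun setT (fun x => (v x `^ a * w x)%:E).
Proof. by apply/measurable_EFinP; apply: measurable_funM => //; exact: mpow. Qed.

Let vw0 a x : (0 <= (v x `^ a * w x)%:E)%E.
Proof. by rewrite lee_fin mulr_ge0 ?powR_ge0. Qed.

(** Integrate [young_tangent] with [s = v * w^(1/p)] over the cube, outside which [w] vanishes; the
    constant term contributes [(p - 1) * h^p] times the volume. *)
Let linear_le_power :
  ((p * h `^ (p - 1))%:E * \int[mu]_x (v x * w x `^ p^-1)%:E
    <= G + ((p - 1) * m)%:E)%E.
Proof.
have pp : 0 < p by exact: lt_trans hp.
have pB : 0 <= p - 1 by rewrite subr_ge0 ltW.
have mQ := @measurable_cube R n r.
have mvw' : measurable_fun setT (fun x => (v x * w x `^ p^-1)%:E).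
  by apply/measurable_EFinP; apply: measurable_funM => //; exact: mpow.
have mi : measurable_fun setT (fun x : E => ((p - 1) * h `^ p * \1_(cube r) x)%:E).
  by apply/measurable_EFinP; apply: measurable_funM.
have -> : ((p - 1) * m)%:E = (\int[mu]_x ((p - 1) * h `^ p * \1_(cube r) x)%:E)%E.
  under eq_integral do rewrite EFinM.
  rewrite ge0_integralZl_EFin//.
  - rewrite integral_indic// setIT -[X in (_ * X)%E]/(mu (cube r)).
    rewrite lebesgue_cube ?(ltW r0)// -EFinM.
    by rewrite /m mulrA.
  - by apply/measurable_EFinP.
  - by rewrite mulr_ge0 ?powR_ge0.
rewrite -ge0_integralZl_EFin//; last 2 first.
- by move=> x _; rewrite lee_fin mulr_ge0 ?powR_ge0.
- by rewrite mulr_ge0 ?powR_ge0// ltW.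
rewrite -ge0_integralD//; last first.
  by move=> x _; rewrite lee_fin !mulr_ge0 ?powR_ge0.
apply: ge0_le_integral => //.
- move=> x _; rewrite -EFinM lee_fin; apply: mulr_ge0.
    by rewrite mulr_ge0 ?powR_ge0// ltW.
  by rewrite mulr_ge0 ?powR_ge0.
- exact: emeasurable_funM.
- exact: emeasurable_funD.
move=> x _; rewrite -EFinM -EFinD lee_fin.
have [wx|wx] := eqVneq (w x) 0.
  by rewrite wx powR0 ?invr_eq0 ?gt_eqF// !mulr0 add0r !mulr_ge0 ?powR_ge0.
rewrite indicE mem_set ?mulr1; last exact: wQ.
have := young_tangent hp (mulr_ge0 (v0 x) (powR_ge0 (w x) p^-1)) h0.
by rewrite powRM ?powR_ge0// -powRrM mulVf ?gt_eqF// powRr1.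
Qed.

(** Cauchy-Schwarz for [v^(p1/2) * w^(1/2)] and [v^(p2/2) * w^(1/2)], whose product is [v^p * w]. *)
Let power_le_product :
  ((2 * m)%:E * G <= (\int[mu]_x (v x `^ p1 * w x)%:E) *
    (\int[mu]_x (v x `^ p2 * w x)%:E) + (m ^+ 2)%:E)%E.
Proof.
pose f a x := v x `^ (a / 2) * w x `^ 2^-1.
have mf a : measurable_fun setT (f a) by apply: measurable_funM; exact: mpow.
have f0 a x : 0 <= f a x by rewrite mulr_ge0 ?powR_ge0.
have m0 : 0 <= m by rewrite mulr_ge0 ?powR_ge0// exprn_ge0// mulr_ge0// ltW.
have half (s : R) : 0 <= s -> s `^ 2^-1 * s `^ 2^-1 = s.
  move=> s0; rewrite -expr2 -powR_mulrn ?powR_ge0// -powRrM mulVf//.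
  by rewrite powRr1.
have fE a b x : 0 < a -> 0 < b -> f a x * f b x = v x `^ ((a + b) / 2) * w x.
  move=> a0 b0; rewrite mulrACA half// mulrDl powRD//.
  by rewrite gt_eqF// addr_gt0// divr_gt0.
have dbl (a : R) : (a + a) / 2 = a by field.
have := cauchy_schwarz_tangent mu (mf p1) (mf p2) (f0 p1) (f0 p2) m0.
under eq_integral do rewrite fE//.
under [X in (_ <= X * _ + _)%E -> _]eq_integral => x _ do
  rewrite expr2 fE// dbl.
under [X in (_ <= _ * X + _)%E -> _]eq_integral => x _ do
  rewrite expr2 fE// dbl.
exact.
Qed.

(** Multiply [linear_le_power] by [2 k m], then bound [2 k m G] by [k] times [power_le_product]. The
    remainders add up to [k m^2 + 2 k (p - 1) m^2 = k (2 p - 1) m^2]. *)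
Lemma slice_estimate : measurable_fun setT X ->
  ((2 * k * m * (p * h `^ (p - 1)))%:E * \int[mu]_x (v x * w x `^ p^-1)%:E
    <= \int[mu]_x X x + (k * (2 * p - 1) * m ^+ 2)%:E)%E.
Proof.
move=> mX; have := power_le_product; have mQ := @measurable_cube R n r.
have k0 : 0 <= k by rewrite mulr_ge0 ?powR_ge0// ltW// riesz_cst_gt0.
have m0 : 0 <= m by rewrite mulr_ge0 ?powR_ge0// exprn_ge0// mulr_ge0// ltW.
set A1 := (\int[mu]_x (v x `^ p1 * w x)%:E)%E.
set B1 := (\int[mu]_x (v x `^ p2 * w x)%:E)%E => power_le.
have B10 : (0 <= B1)%E by apply: integral_ge0 => x _.
have A10 : (0 <= A1)%E by apply: integral_ge0 => x _.
pose AQ := (\int[mu]_(x in cube r) (v x `^ p1)%:E)%E.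
have AQ0 : (0 <= AQ)%E.
  by apply: integral_ge0 => x _; rewrite lee_fin powR_ge0.
have mv1 : measurable_fun setT (fun x => (v x `^ p1)%:E).
  by apply/measurable_EFinP; exact: mpow.
have A1Q : (A1 <= AQ)%E.
  rewrite /AQ integral_mkcond; apply: ge0_le_integral => //.
  - by apply/(measurable_restrictT _ mQ); exact: measurable_funTS.
  - move=> x _; rewrite patchE; case: ifPn => [_|xQ].
      by rewrite lee_fin ler_piMr ?powR_ge0//; case/andP: (w01 x).
    rewrite (_ : w x = 0) ?mulr0//; apply/eqP; apply: contraNT xQ => /wQ.
    by move/mem_set.
(* Wherever [w] is nonzero the point lies in the cube, so [riesz_ge] bounds the potential below by
   [k * AQ], which dominates [k * A1]. *)
have key : (k%:E * (A1 * B1) <= \int[mu]_x X x)%E.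
  apply: (@le_trans _ _ ((k%:E * AQ) * B1)%E).
    rewrite -muleA; apply: lee_wpmul2l; first by rewrite lee_fin.
    exact: lee_wpmul2r.
  rewrite -ge0_integralZl//; last by rewrite mule_ge0// lee_fin.
  apply: ge0_le_integral => //.
  - by move=> x _; rewrite !mule_ge0// ?lee_fin ?mulr_ge0 ?powR_ge0.
  - exact: measurable_funeM.
  - move=> x _; rewrite /X.
    have [->|wx] := eqVneq (w x) 0; first by rewrite mulr0 !mule0.
    rewrite (EFinM (v x `^ p2)) muleA lee_wpmul2r ?lee_fin//.
    rewrite lee_wpmul2r ?lee_fin ?powR_ge0//.
    apply: riesz_ge => //; [exact: wQ|exact: mpow|].
    by move=> y; exact: powR_ge0.
apply: (@le_trans _ _ ((2 * k * m)%:E * (G + ((p - 1) * m)%:E))%E).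
  rewrite (EFinM (2 * k * m)) -muleA; apply: lee_wpmul2l linear_le_power.
  by rewrite lee_fin mulr_ge0// mulr_ge0.
have G0 : (0 <= G)%E by apply: integral_ge0 => x _.
have pB : 0 <= p - 1 by rewrite subr_ge0 ltW.
rewrite ge0_muleDr//; last by rewrite lee_fin mulr_ge0.
rewrite (_ : 2 * k * m = k * (2 * m)); last by ring.
rewrite {1}(EFinM k) -muleA.
apply: (@le_trans _ _ (k%:E * (A1 * B1 + (m ^+ 2)%:E) +
    (k * (2 * m))%:E * ((p - 1) * m)%:E)%E).
  by rewrite leeD2r// lee_wpmul2l// lee_fin.
rewrite ge0_muleDr; [|exact: mule_ge0|by rewrite lee_fin sqr_ge0].
rewrite -addeA -!EFinM -EFinD; apply: leeD => //.
by rewrite lee_fin le_eqVlt; apply/orP; left; apply/eqP; ring.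
Qed.

End slice_estimate.

(** * Integration in time and use of the weak formulation *)

Section data_estimate.
Context {R : realType} {n : nat}.
Local Notation E := 'rV[R]_n.
Local Notation ST := (measurableTypeR R * 'rV[R]_n)%type.
Local Notation mu := (@lebesgue_rV R n).
Local Notation leb := (@lebesgue_measure R).
Hypothesis n0 : (0 < n)%N.
Variables (gamma p1 p2 : R) (u : R * E -> R).
Hypotheses (hgamma : 0 < gamma < n%:R) (p10 : 0 < p1) (p20 : 0 < p2).
Hypothesis hp : 1 < (p1 + p2) / 2.
Let p := (p1 + p2) / 2.
Let N : ST -> \bar R := nonlinearity gamma p1 p2 u.
Hypothesis mu_u : measurable_fun (halfspace : set ST) u.
Hypothesis mN : measurable_fun (halfspace : set ST) N.

Lemma riesz_ge0 (f : E -> R) x : (forall y, 0 <= f y) -> (0 <= riesz gamma f x)%E.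
Proof.
move=> f0; apply: mule_ge0; first by rewrite lee_fin ltW// riesz_cst_gt0.
by apply: integral_ge0 => y _; rewrite lee_fin divr_ge0// powR_ge0.
Qed.

Lemma nonlinearity_ge0 z : (0 <= N z)%E.
Proof.
apply: mule_ge0; last by rewrite lee_fin powR_ge0.
by apply: riesz_ge0 => y; exact: powR_ge0.
Qed.

Variables (r h : R).
Hypotheses (r0 : 0 < r) (h0 : 0 <= h).
Let T := r ^+ 2.
Let phi : ST -> R := cutoff T r.
Let k := @riesz_cst R n gamma * (2 * n%:R * r) `^ (gamma - n%:R).
Let m := h `^ p * (2 * r) ^+ n.
Let c := 2 * k * m * (p * h `^ (p - 1)).

Let T0 : 0 < T. Proof. exact: exprn_gt0. Qed.

Let pp : 0 < p. Proof. exact: lt_trans hp. Qed.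

Let k0 : 0 <= k.
Proof. by rewrite mulr_ge0 ?powR_ge0// ltW// riesz_cst_gt0. Qed.

Let m0 : 0 <= m.
Proof. by rewrite mulr_ge0 ?powR_ge0// exprn_ge0// mulr_ge0// ltW. Qed.

Let c0 : 0 <= c.
Proof.
apply: mulr_ge0; first by rewrite mulr_ge0// mulr_ge0.
by rewrite mulr_ge0 ?powR_ge0// ltW.
Qed.

Let mH := @measurable_halfspace R n.

Let mphi : measurable_fun (setT : set ST) phi := measurable_cutoff T r.

Let phi0 z : 0 <= phi z. Proof. exact: cutoff_ge0. Qed.

Let mphip : measurable_fun (setT : set ST) (fun z => phi z `^ p^-1).
Proof.
by apply: (@measurableT_comp _ _ _ _ _ _ (fun s : R => s `^ p^-1) _ phi).
Qed.

Let a (z : ST) : \bar R := (N z * (phi z)%:E)%E.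
Let b (z : ST) : \bar R := (`|u z| * phi z `^ p^-1)%:E.

Let ma : measurable_fun halfspace a.
Proof.
apply: emeasurable_funM => //.
by apply: measurable_funTS; exact/measurable_EFinP.
Qed.

Let mb : measurable_fun halfspace b.
Proof.
apply/measurable_EFinP; apply: measurable_funM; last exact: measurable_funTS.
exact: measurableT_comp.
Qed.

Let a0 z : (0 <= a z)%E.
Proof. by rewrite mule_ge0 ?nonlinearity_ge0// lee_fin. Qed.

Let b0 z : (0 <= b z)%E.
Proof. by rewrite lee_fin mulr_ge0// powR_ge0. Qed.

Let maH : measurable_fun (setT : set ST) (a \_ halfspace).
Proof. exact/(measurable_restrictT _ mH). Qed.

Let mbH : measurable_fun (setT : set ST) (b \_ halfspace).
Proof. exact/(measurable_restrictT _ mH). Qed.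

Let aH0 (z : ST) : (0 <= (a \_ halfspace) z)%E.
Proof. by rewrite patchE; case: ifP. Qed.

Let bH0 (z : ST) : (0 <= (b \_ halfspace) z)%E.
Proof. by rewrite patchE; case: ifP. Qed.

Let restrE (f : ST -> \bar R) t x : 0 <= t -> (f \_ halfspace) (t, x) = f (t, x).
Proof. by move=> t0; rewrite patchE mem_set. Qed.

(** For [t] outside [[0, T]] the cutoff or the restriction to the half-space kills the left-hand
    side. The remainder thus carries an indicator, which makes it integrable in time. *)
Let slice t :
  (c%:E * \int[mu]_x (b \_ halfspace) (t, x)
    <= \int[mu]_x (a \_ halfspace) (t, x)
       + (k * (2 * p - 1) * m ^+ 2 * \1_(`[0, T]%classic) t)%:E)%E.
Proof.
have int_a0 : (0 <= \int[mu]_x (a \_ halfspace) (t, x))%E.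
  exact: integral_ge0.
have [tT|tT] := boolP (t \in `[0, T]%classic); last first.
  rewrite (_ : (\int[mu]_x _ = 0)%E) ?mule0.
    by rewrite indicE (negbTE tT) mulr0 adde0.
  apply: integral0_eq => x _; rewrite patchE; case: ifPn => // tH.
  rewrite /b (_ : phi (t, x) = 0) ?powR0 ?mulr0// ?invr_eq0 ?gt_eqF//.
  apply/eqP; apply: contraNT tT => /(cutoff_support T0 r0 (set_mem tH))[+ _].
  by move/mem_set.
have t0 : 0 <= t by move: tT; rewrite inE /= in_itv/= => /andP[].
rewrite indicE tT mulr1.
under eq_integral do rewrite restrE//.
under [X in (_ <= X + _)%E]eq_integral do rewrite restrE//.
apply: (@slice_estimate R n n0 gamma p1 p2 r h (fun x => `|u (t, x)|)
  (fun x => phi (t, x))) => //.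
- apply: measurableT_comp => //.
  have : measurable_fun (setT : set ST) (u \_ halfspace).
    exact/(measurable_restrictT _ mH).
  move/(measurable_fun_pair2 t); apply: eq_measurable_fun => x _.
  by rewrite patchE mem_set.
- exact: measurable_fun_pair2 mphi.
- by move=> x; rewrite phi0 cutoff_le1.
- by move=> x /(cutoff_support T0 r0 (t0 : halfspace (t, x)))[].
- have := measurable_fun_pair2 t maH; apply: eq_measurable_fun => x _.
  by rewrite restrE.
Qed.

Lemma spacetime_estimate :
  (c%:E * \int[lebesgue_spacetime]_(z in halfspace) b z
    <= \int[lebesgue_spacetime]_(z in halfspace) a z
       + (k * (2 * p - 1) * m ^+ 2 * T)%:E)%E.
Proof.
rewrite integral_mkcond [X in (_ <= X + _)%E]integral_mkcond /lebesgue_spacetime.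
rewrite !fubini_tonelli1//.
have mFa : measurable_fun setT (fubini_F mu (a \_ halfspace)).
  exact: measurable_fun_fubini_tonelli_F.
have mFb : measurable_fun setT (fubini_F mu (b \_ halfspace)).
  exact: measurable_fun_fubini_tonelli_F.
rewrite -ge0_integralZl//; last by move=> t _; apply: integral_ge0.
have C0 : 0 <= k * (2 * p - 1) * m ^+ 2.
  rewrite mulr_ge0 ?sqr_ge0// mulr_ge0//.
  by have := hp; rewrite -/p; lra.
have mI : measurable_fun (setT : set R)
    (fun t : R => (k * (2 * p - 1) * m ^+ 2 * \1_(`[0%R, T]%classic) t)%:E).
  by apply/measurable_EFinP; apply: measurable_funM.
have -> : ((k * (2 * p - 1) * m ^+ 2 * T)%:E =
    \int[leb]_t (k * (2 * p - 1) * m ^+ 2 * \1_(`[0%R, T]%classic) t)%:E)%E.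
  under eq_integral do rewrite EFinM.
  rewrite ge0_integralZl_EFin//.
  - rewrite integral_indic//= setIT lebesgue_measure_itv/= lte_fin T0.
    by rewrite oppr0 addr0.
  - by apply/measurable_EFinP.
rewrite -ge0_integralD//; last 2 first.
- by move=> t _; apply: integral_ge0.
- by move=> t _; rewrite lee_fin mulr_ge0.
apply: ge0_le_integral => //.
- by move=> t _; rewrite mule_ge0 ?lee_fin//; apply: integral_ge0.
- exact: measurable_funeM.
- exact: emeasurable_funD.
- by move=> t _; exact: slice.
Qed.

(** By the equation, the nonlinear term plus the data term is at most [M] times the integral of [b].
    As [M <= c], [spacetime_estimate] bounds this by the same nonlinear term plus the remainder, and
    the nonlinear term cancels. *)
Lemma data_estimate (u0 u1 : E -> R) (M : R) :
  weak_solution gamma p1 p2 u0 u1 u ->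
  (forall z, `|damped_wave phi z| <= M * phi z `^ p^-1) -> M <= c ->
  (\int[mu]_x ((u0 x + u1 x) * cutoff T r (0%R, x))%:E
    <= (k * (2 * p - 1) * m ^+ 2 * T)%:E)%E.
Proof.
move=> [_ [_ iN] /(_ phi (test_function_cutoff T0 r0)) eqn] LM Mc.
have E0 : (\int[mu]_x (u0 x * dt phi (0%R, x))%:E = 0)%E.
  by apply: integral0_eq => x _; rewrite dt_cutoff0 mulr0.
rewrite E0 sube0 in eqn.
have mK := @measurable_cylinder R n T r.
have KH := @cylinder_halfspace R n T r.
(* Cancelling the nonlinear term requires it to be finite: the cutoff is at most [1] and, within the
   half-space, lives on a compact cylinder, where [N] is integrable. *)
have fin_a : (\int[lebesgue_spacetime]_(z in halfspace) a z)%E \is a fin_num.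
  rewrite ge0_fin_numE; last by apply: integral_ge0.
  have /integrableP[_ iNK] := iN _ (compact_cylinder (T := T) (r := r)) KH.
  apply: le_lt_trans iNK; rewrite integral_mkcond [leRHS]integral_mkcond.
  apply: ge0_le_integral => //.
  - apply/(measurable_restrictT _ mK); apply: measurableT_comp => //.
    exact: measurable_funS mN.
  move=> z _; rewrite !patchE; case: ifPn => zH; last first.
    by case: ifPn => // _; exact: abse_ge0.
  case: ifPn => zK; last first.
    rewrite /a (_ : phi z = 0) ?mule0//; apply/eqP; apply: contraNT zK.
    by move=> /(cutoff_support T0 r0 (set_mem zH)) /mem_set.
  rewrite gee0_abs ?nonlinearity_ge0// -[leRHS]mule1 lee_wpmul2l ?nonlinearity_ge0//.
  by rewrite lee_fin cutoff_le1.
rewrite -(leeD2lE _ _ fin_a) [leLHS]eqn.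
apply: le_trans spacetime_estimate.
have mL : measurable_fun halfspace
    (fun z : ST => (u z * damped_wave phi z)%:E).
  apply/measurable_EFinP; apply: measurable_funM => //.
  by apply: measurable_funTS; exact: measurable_damped_wave_cutoff.
apply: le_trans (lee_abs _) _; apply: le_trans; first exact: le_abse_integral.
rewrite -ge0_integralZl//.
apply: ge0_le_integral => //.
- exact: measurableT_comp.
- exact: measurable_funeM.
move=> z _; rewrite abse_EFin /b -EFinM lee_fin normrM mulrCA ler_wpM2l//.
by apply: le_trans (LM z) _; rewrite ler_wpM2r ?powR_ge0.
Qed.

End data_estimate.

(** * The data term and the contradiction *)

Section data_lower_bound.
Context {R : realType} {n : nat}.
Local Notation E := 'rV[R]_n.
Local Notation mu := (@lebesgue_rV R n).
Hypothesis n0 : (0 < n)%N.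

Let ln_gt0 (x : R) : 0 <= x -> 0 < ln (expR 1 + x).
Proof.
move=> x0; apply: (@lt_le_trans _ _ (ln (expR 1))); first by rewrite expRK.
by rewrite ler_ln ?posrE ?ltr_pwDl ?expR_gt0// lerDl.
Qed.

Lemma jbracket_le (x : E) (a : R) : 1 <= a -> enorm x <= a -> jbracket x <= 2 * a.
Proof.
move=> a1 xa; have x0 : 0 <= enorm x by exact: sqrtr_ge0.
have e0 : 0 <= 2 * a by rewrite mulr_ge0// (le_trans _ a1).
rewrite /jbracket -[leRHS](ger0_norm e0) -sqrtr_sqr; apply: ler_wsqrtr.
rewrite exprMn; apply: (@le_trans _ _ (a ^+ 2 + a ^+ 2)); last first.
  by have := sqr_ge0 a; lra.
by apply: lerD; [exact: exprn_ege1|rewrite lerXn2r// nnegrE (le_trans x0)].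
Qed.

Lemma jbracket_gt0 (x : E) : 0 < jbracket x.
Proof. by rewrite sqrtr_gt0 ltr_pwDl// sqr_ge0. Qed.

(** Only the cube of half-side [r / 2] is kept: its volume is [r ^+ n], the cutoff is bounded below
    there by [cutoff_ge], and [enorm x <= n r] bounds the decaying weight below. *)
Lemma data_lower_bound (U : E -> R) (c s r : R) : 0 < c -> 0 <= s -> 1 <= r ->
  measurable_fun setT U ->
  {ae mu, forall x, c * jbracket x `^ (- s) / ln (expR 1 + enorm x) <= U x} ->
  ((c * (2 * (n%:R * r)) `^ (- s) / ln (expR 1 + n%:R * r)
      * expR (- 2) ^+ n.+1 * r ^+ n)%:E
    <= \int[mu]_x (U x * cutoff (r ^+ 2) r (0%R, x))%:E)%E.
Proof.
move=> c0 s0 r1 mU aeU; have r0 : 0 < r by exact: lt_le_trans r1.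
pose phi x := cutoff (r ^+ 2) r (0 : R, x : E).
have mphi : measurable_fun setT phi.
  exact: (measurable_fun_pair2 (0 : R) (measurable_cutoff (r ^+ 2) r)).
have mUphi : measurable_fun setT (fun x => (U x * phi x)%:E).
  by apply/measurable_EFinP; exact: measurable_funM.
have lb0 (x : E) : 0 <= c * jbracket x `^ (- s) / ln (expR 1 + enorm x).
  rewrite divr_ge0 ?mulr_ge0 ?powR_ge0 ?(ltW c0)// ltW// ln_gt0//.
  exact: sqrtr_ge0.
have nr1 : 1 <= n%:R * r by rewrite -[leLHS]mul1r ler_pM// ler1n.
set A := c * _ / _.
have A0 : 0 <= A.
  rewrite divr_ge0 ?mulr_ge0 ?powR_ge0 ?(ltW c0)// ltW// ln_gt0//.
  exact: le_trans nr1.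
have lb (x : E) : cube (r / 2) x ->
    A <= c * jbracket x `^ (- s) / ln (expR 1 + enorm x).
  move/cubeP => xr; have xnr : enorm x <= n%:R * r.
    apply: le_trans (enorm_le n0 _ xr) _; first by rewrite divr_ge0// ltW.
    by rewrite ler_wpM2l//; lra.
  have x0 : 0 <= enorm x by exact: sqrtr_ge0.
  apply: ler_pM.
  - by rewrite mulr_ge0 ?powR_ge0 ?(ltW c0).
  - by rewrite invr_ge0 ltW// ln_gt0// (le_trans _ nr1).
  - rewrite ler_wpM2l ?(ltW c0)// !powRN lef_pV2 ?posrE; last 2 first.
    + by rewrite powR_gt0// mulr_gt0// (lt_le_trans _ nr1).
    + by rewrite powR_gt0// jbracket_gt0.
    apply: ge0_ler_powR; rewrite ?nnegrE ?(ltW (jbracket_gt0 _)) ?jbracket_le//.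
    by rewrite mulr_ge0// (le_trans _ nr1).
  - rewrite lef_pV2 ?posrE ?ln_gt0 ?(le_trans _ nr1)//.
    by rewrite ler_ln ?posrE ?ltr_pwDl ?expR_gt0 ?(le_trans _ nr1)// lerD2l.
have mQ := @measurable_cube R n (r / 2).
(* The integrand is nonnegative only almost everywhere; the absolute value makes it so everywhere,
   as shrinking the domain of integration requires. *)
have -> : (\int[mu]_x (U x * cutoff (r ^+ 2) r (0%R, x))%:E =
    \int[mu]_x `|(U x * phi x)%:E|)%E.
  apply: ae_eq_integral => //; first exact: measurableT_comp.
  apply: filterS aeU => x Ux _; rewrite gee0_abs// lee_fin.
  by rewrite mulr_ge0 ?cutoff_ge0// (le_trans (lb0 x)).
apply: (@le_trans _ _ (\int[mu]_(x in cube (r / 2)) `|(U x * phi x)%:E|)%E);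
  last first.
  by apply: ge0_subset_integral => //; exact: measurableT_comp.
apply: (@le_trans _ _ (\int[mu]_(x in cube (r / 2)) (A * expR (- 2) ^+ n.+1)%:E)%E).
  rewrite integral_cst// -[X in (_ <= _ * X)%E]/(mu (cube (r / 2))).
  rewrite lebesgue_cube ?divr_ge0 ?(ltW r0)// -EFinM lee_fin.
  by rewrite mulrCA divff// mulr1.
have e0 : 0 <= expR (- 2) ^+ n.+1 :> R by rewrite exprn_ge0// expR_ge0.
apply: ae_ge0_le_integral => //.
- by move=> x _; rewrite lee_fin mulr_ge0.
- by apply: measurableT_comp => //; exact: measurable_funTS.
apply: filterS aeU => x Ux xQ; rewrite abse_EFin lee_fin ger0_norm; last first.
  by rewrite mulr_ge0 ?cutoff_ge0// (le_trans (lb0 x)).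
apply: ler_pM => //; first exact: le_trans (lb _ xQ) Ux.
by apply: cutoff_ge => //; exact/cubeP.
Qed.

End data_lower_bound.

(** With [e = delta / 2], the bound [e * ln y <= y^e] at [y = (expR 1 + a) * r] turns the hypothesis
    into boundedness of [r^e]. *)
Lemma powR_not_le_ln {R : realType} (delta C a : R) : 0 < delta -> 0 <= a ->
  ~ (forall r, 1 <= r -> r `^ delta <= C * ln (expR 1 + a * r)).
Proof.
move=> d0 a0 H; pose e := delta / 2; have e0 : 0 < e by rewrite divr_gt0.
have E0 : 0 < expR 1 + a by rewrite ltr_pwDl// expR_gt0.
pose C' := `|C| * ((expR 1 + a) `^ e / e).
have C'0 : 0 <= C' by rewrite mulr_ge0// divr_ge0 ?powR_ge0// ltW.
have bound r : 1 <= r -> r `^ e <= C'.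
  move=> r1; have r0 : 0 < r by exact: lt_le_trans r1.
  have re0 : 0 < r `^ e by rewrite powR_gt0.
  have arp : 0 < expR 1 + a * r by rewrite ltr_pwDl ?expR_gt0// mulr_ge0// ltW.
  rewrite -(ler_pM2r re0) -powRD; last by rewrite (gt_eqF r0) implybT.
  rewrite -splitr; apply: le_trans (H r r1) _.
  have ln0 : 0 <= ln (expR 1 + a * r).
    rewrite ln_ge0// -[leLHS]addr0 lerD//; last by rewrite mulr_ge0// ltW.
    by rewrite -expR0 ler_expR.
  apply: le_trans (ler_wpM2r ln0 (ler_norm C)) _.
  rewrite /C' -mulrA ler_wpM2l// mulrAC -powRM ?(ltW r0) ?(ltW E0)//.
  rewrite ler_pdivlMr// mulrC; apply: (@le_trans _ _ (e * ln ((expR 1 + a) * r))).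
    rewrite ler_wpM2l ?(ltW e0)// ler_ln ?posrE ?mulr_gt0//.
    by rewrite mulrDl lerD2r ler_peMr// expR_ge0.
  rewrite /powR gt_eqF ?mulr_gt0//; apply: le_trans (expR_ge1Dx _).
  by rewrite lerDr.
(* At this [r] the power [r^e] equals [C' + 1], which exceeds the bound [C']. *)
have r1 : 1 <= (C' + 1) `^ e^-1.
  rewrite -[leLHS](@powRr0 _ (C' + 1)); apply: ler_powR.
    by rewrite lerDr.
  by rewrite invr_ge0 ltW.
have := bound _ r1; rewrite -powRrM mulVf ?gt_eqF// powRr1 ?addr_ge0//.
by rewrite gerDl ler10.
Qed.

(** * Powers of [r] when the tangent point is [h = H * r^(- sigma)] *)

Section scaling.
Context {R : realType}.
Variables (n : nat) (gamma p sigma K H r : R).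
Hypotheses (H0 : 0 < H) (r0 : 0 < r) (hsigma : (2 * p - 1) * sigma = 2 + gamma).
Let h := H * r `^ (- sigma).
Let k := K * (2 * n%:R * r) `^ (gamma - n%:R).
Let m := h `^ p * (2 * r) ^+ n.

Let rD (a b : R) : r `^ a * r `^ b = r `^ (a + b).
Proof. by rewrite powRD// (gt_eqF r0) implybT. Qed.

Let hpow (a : R) : h `^ a = H `^ a * r `^ (- sigma * a).
Proof. by rewrite /h powRM ?powR_ge0 ?(ltW H0)// -powRrM. Qed.

Let kE : k = K * (2 * n%:R) `^ (gamma - n%:R) * r `^ (gamma - n%:R).
Proof. by rewrite /k powRM ?mulr_ge0 ?(ltW r0)// mulrA. Qed.

Let mE : m = H `^ p * 2 ^+ n * r `^ (- sigma * p + n%:R).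
Proof.
rewrite /m hpow exprMn -(powR_mulrn n (ltW r0)) -rD; ring.
Qed.

(** The exponents of [r] sum to [gamma - (2 p - 1) sigma], and [sigma] is chosen to make this [- 2],
    the decay of the damped wave operator on the cutoff. *)
Lemma scaling_absorption : 2 * k * m * (p * h `^ (p - 1)) =
  2 * p * K * (2 * n%:R) `^ (gamma - n%:R) * 2 ^+ n * H `^ (2 * p - 1) * r ^- 2.
Proof.
have -> : H `^ (2 * p - 1) = H `^ p * H `^ (p - 1).
  by rewrite -powRD ?(gt_eqF H0) ?implybT//; congr (_ `^ _); ring.
have -> : r ^- 2 =
    r `^ (gamma - n%:R) * r `^ (- sigma * p + n%:R) * r `^ (- sigma * (p - 1)).
  rewrite !rD -(powR_mulrn 2 (ltW r0)) -powRN; congr (_ `^ _).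
  by move: hsigma; lra.
by rewrite mE kE hpow; ring.
Qed.

(** The total exponent is [gamma + 2 + n - 2 p sigma], which is [n - sigma] by the choice of
    [sigma]; the last factor [r ^+ 2] is the duration [T]. *)
Lemma scaling_remainder : k * (2 * p - 1) * m ^+ 2 * r ^+ 2 =
  K * (2 * n%:R) `^ (gamma - n%:R) * (2 * p - 1) * (H `^ p * 2 ^+ n) ^+ 2
    * r `^ (n%:R - sigma).
Proof.
have -> : r `^ (n%:R - sigma) = r `^ (gamma - n%:R) *
    (r `^ (- sigma * p + n%:R) * r `^ (- sigma * p + n%:R)) * r ^+ 2.
  rewrite -(powR_mulrn 2 (ltW r0)) !rD; congr (_ `^ _).
  by move: hsigma; lra.
by rewrite mE kE; ring.
Qed.

End scaling.

Theorem theorem1p3 (R : realType) (n : nat) (gamma beta p1 p2 : R)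
    (phi u0 u1 : 'rV[R]_n -> R) :
  (0 < n)%N ->
  0 < gamma < n%:R ->
  0 <= beta < n%:R / 2 ->
  1 <= p1 -> 1 <= p2 ->
  littlewood_paley phi ->
  L1loc_besov phi beta u0 ->
  L1loc_besov phi beta u1 ->
  (exists2 c : R, 0 < c &
     {ae lebesgue_rV n, forall x,
        c * jbracket x `^ (- (n%:R / 2) - beta) / ln (expR 1 + enorm x)
          <= u0 x + u1 x}) ->
  2 < p1 + p2 < 1 + (4 + 2 * gamma) / (n%:R + 2 * beta) ->
  ~ exists u : R * 'rV[R]_n -> R, weak_solution gamma p1 p2 u0 u1 u.
Proof.
move=> n0 hgamma /andP[beta0 _] p11 p21 _ [[mu0 _] _] [[mu1 _] _] [c c0 aeU].
move=> /andP[hp2 hsub] [u sol].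
have [[mu_u _] [mN _] _] := sol.
have /andP[g0 gn] := hgamma.
have p10 : 0 < p1 by exact: lt_le_trans p11.
have p20 : 0 < p2 by exact: lt_le_trans p21.
have hp : 1 < (p1 + p2) / 2 by lra.
pose p := (p1 + p2) / 2; have p0 : 0 < p by exact: lt_trans hp.
have q0 : 0 < 2 * p - 1 by rewrite /p; lra.
have theta01 : 0 < p^-1 < 1 by rewrite invr_gt0 p0 invf_lt1.
have [C1 C10 HC1] := @damped_wave_cutoff_le R n _ theta01.
pose sigma := (2 + gamma) / (2 * p - 1).
have hsigma : (2 * p - 1) * sigma = 2 + gamma by rewrite mulrC divfK ?gt_eqF.
pose s := n%:R / 2 + beta.
have nR0 : 0 < n%:R :> R by rewrite ltr0n.
have s0 : 0 <= s by rewrite addr_ge0// divr_ge0// ltW.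
(* Since [2 p - 1 = p1 + p2 - 1], this is the subcriticality assumption after clearing
   denominators. *)
have s_sigma : s < sigma.
  rewrite ltr_pdivlMr//; move: hsub; rewrite -ltrBlDl ltr_pdivlMr; last first.
    by rewrite ltr_pwDl// mulr_ge0.
  by rewrite /s /p; lra.
pose K := @riesz_cst R n gamma.
have K0 : 0 < K by exact: riesz_cst_gt0.
pose D := 2 * p * K * (2 * n%:R) `^ (gamma - n%:R) * 2 ^+ n.
have n2gt0 : 0 < 2 * n%:R :> R by rewrite mulr_gt0.
have D0 : 0 < D.
  apply: mulr_gt0; last exact: exprn_gt0.
  by apply: mulr_gt0; [do 2 apply: mulr_gt0 => //|exact: powR_gt0].
(* This solves [D * H^(2 p - 1) = C1], so that the absorption condition [M <= c] of [data_estimate]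
   holds with equality for every [r]. *)
pose H := (C1 / D) `^ (2 * p - 1)^-1.
have H0 : 0 < H by rewrite powR_gt0// divr_gt0.
have HE : D * H `^ (2 * p - 1) = C1.
  rewrite -powRrM mulVf ?gt_eqF// powRr1 ?divr_ge0 ?ltW//.
  by rewrite mulrC divfK ?gt_eqF.
pose C2 := K * (2 * n%:R) `^ (gamma - n%:R) * (2 * p - 1) * (H `^ p * 2 ^+ n) ^+ 2.
pose B := c * (2 * n%:R) `^ (- s) * expR (- 2) ^+ n.+1.
have B0 : 0 < B by rewrite !mulr_gt0 ?powR_gt0 ?exprn_gt0 ?expR_gt0.
have d0 : 0 < sigma - s by rewrite subr_gt0.
(* Comparing the lower bound [B r^(n - s) / ln (expR 1 + n r)] with the upper bound
   [C2 r^(n - sigma)] bounds [r^(sigma - s)] by a multiple of the logarithm. *)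
apply: (@powR_not_le_ln _ _ (C2 / B) _ d0 (ltW nR0)) => r r1.
have r0 : 0 < r by exact: lt_le_trans r1.
have h0 : 0 <= H * r `^ (- sigma) by rewrite mulr_ge0 ?powR_ge0 ?(ltW H0).
have upper := @data_estimate R n n0 gamma p1 p2 u hgamma p10 p20 hp mu_u mN
  r _ r0 h0 u0 u1 (C1 * r ^- 2) sol (fun z => HC1 r z r1).
rewrite scaling_absorption// scaling_remainder// -/p -/K -/D HE in upper.
have lower := @data_lower_bound R n n0 (fun x => u0 x + u1 x) c s r c0 s0 r1.
have mU : measurable_fun setT (fun x => u0 x + u1 x) by exact: measurable_funD.
rewrite -opprD in aeU.
have {upper lower} := le_trans (lower mU aeU) (upper (lexx _)).
rewrite lee_fin -/C2; set L := ln _.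
have L0 : 0 < L.
  apply: (@lt_le_trans _ _ (ln (expR 1))); first by rewrite expRK.
  rewrite ler_ln ?posrE ?ltr_pwDl ?expR_gt0 ?lerDl// mulr_ge0 ?ltW//.
have rE : r `^ (sigma - s) * r `^ (n%:R - sigma) = r `^ (- s) * r ^+ n.
  rewrite -(powR_mulrn n (ltW r0)) -!powRD ?(gt_eqF r0) ?implybT//.
  by congr (_ `^ _); ring.
move=> main.
have rn0 : 0 < r `^ (n%:R - sigma) by rewrite powR_gt0.
rewrite -(ler_pM2r rn0) rE mulrAC -(ler_pM2l B0).
rewrite -(ler_pM2r L0) in main.
have -> : B * (r `^ (- s) * r ^+ n) =
    c * (2 * (n%:R * r)) `^ (- s) / L * expR (- 2) ^+ n.+1 * r ^+ n * L.
  rewrite [2 * _]mulrA powRM ?(ltW r0) ?(ltW n2gt0)// /B; field.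
  by rewrite gt_eqF.
have cancel (b x y z : R) : 0 < b -> b * (x / b * y * z) = x * y * z.
  by move=> b0; field; rewrite gt_eqF.
by rewrite cancel.
Qed.
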